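(* Let $\beta\in[0,1]$, $m>0$, $\sigma\ge0$, and let $C=C(\beta,m,\sigma)$ be the constant of the modified log-Sobolev inequality for convex functions recalled in the context. Let $X_1,\dots,X_n$ be independent real random variables whose laws all belong to $\mathcal{M}_\beta(m,\sigma^{\beta+1})$, let $X=(X_1,\dots,X_n)$, and let $\varphi\colon\mathbb{R}^n\to\mathbb{R}$ be a convex function such that $$|\varphi(x)-\varphi(y)|\le L_2\|x-y\|_2\quad\text{and}\quad|\varphi(x)-\varphi(y)|\le L_{1+\beta}\|x-y\|_{1+\beta}$$ for all $x,y\in\mathbb{R}^n$ and some $L_2,L_{1+\beta}<\infty$. Then, for $\beta\in(0,1]$ and all $t\ge0$, $$\mathbb{P}\big(\varphi(X)\ge\mathbb{E}\varphi(X)+t\big)\le\exp\Big(-\frac{3}{16}\min\Big\{\frac{t^2}{CL_2^2},\frac{t^{1+\beta}}{C^\beta L_{1+\beta}^{1+\beta}}\Big\}\Big).$$ If $\beta=0$, then for all $t\ge0$, $$\mathbb{P}\big(\varphi(X)\ge\mathbb{E}\varphi(X)+t\big)\le\exp\Big(-\frac14\min\Big\{\frac{t^2}{CL_2^2},\frac{t}{(m+3\sigma)L_1}\Big\}\Big).$$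
   Context: For $\beta\in[0,1]$, $m>0$, $\sigma\ge 0$, $\mathcal{M}_\beta(m,\sigma^{\beta+1})$ denotes the class of probability measures $\mu$ on $\mathbb{R}$ such that $$\forall_{x\ge m}\ \ \nu^+([x,\infty))\le\sigma^{\beta+1}\mu([x,\infty)),\qquad \forall_{x\le -m}\ \ \nu^-((-\infty,x])\le\sigma^{\beta+1}\mu((-\infty,x]),$$ where $\nu^+$ is the measure on $[m,\infty)$ with (Lebesgue) density $x^\beta\mu([x,\infty))$ and $\nu^-$ is the measure on $(-\infty,-m]$ with density $|x|^\beta\mu((-\infty,x])$. The constant $C=C(\beta,m,\sigma)\in(0,\infty)$ is a constant, depending only on $\beta,m,\sigma$, such that for every $n\ge1$, all independent $X_1,\dots,X_n$ with laws in $\mathcal{M}_\beta(m,\sigma^{\beta+1})$ (write $X=(X_1,\dots,X_n)$) and every smooth convex $\psi\colon\mathbb{R}^n\to\mathbb{R}$: - if $\beta\in(0,1]$, $\operatorname{Ent}e^{\psi(X)}\le C\,\mathbb{E}\big[\big(|\nabla\psi(X)|^2\vee\|\nabla\psi(X)\|_{(\beta+1)/\beta}^{(\beta+1)/\beta}\big)e^{\psi(X)}\big]$; - if $\beta=0$ and $|\partial_i\psi|\le 1/(2(m+3\sigma))$ everywhere for all $i$, $\operatorname{Ent}e^{\psi(X)}\le C\,\mathbb{E}\big[|\nabla\psi(X)|^2e^{\psi(X)}\big]$. (Such a constant exists by a theorem of the same paper.) Here $\operatorname{Ent}Y=\mathbb{E}Y\log Y-\mathbb{E}Y\log\mathbb{E}Y$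 if $\mathbb{E}Y\log Y<\infty$ and $\operatorname{Ent}Y=\infty$ otherwise; $\|\cdot\|_p$ is the $\ell_p^n$ norm and $|\cdot|=\|\cdot\|_2$. *)

(* Defs.v *)
From HB Require Import structures.
From mathcomp Require Import all_boot all_order all_algebra.
From mathcomp Require Import all_classical all_reals all_analysis.

Set Implicit Arguments.
Unset Strict Implicit.
Unset Printing Implicit Defensive.

Import Order.TTheory GRing.Theory Num.Theory.
Import numFieldNormedType.Exports.

Local Open Scope classical_set_scope.
Local Open Scope ring_scope.

Section vectors.
Context {R : realType} {n : nat}.
Implicit Types (x : 'rV[R]_n) (f : 'rV[R]_n -> R).

Definition lpnorm (p : R) x : R := (\sum_(i < n) `|x 0 i| `^ p) `^ p^-1.

Definition partial (i : 'I_n) f : 'rV[R]_n -> R :=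
  fun x => 'D_(delta_mx 0 i) f x.

Definition grad f x : 'rV[R]_n := \row_i partial i f x.

Definition iter_partial (s : seq 'I_n) f : 'rV[R]_n -> R := foldr partial f s.

(* C^oo: the iterated partial derivatives of every order exist everywhere and
   are continuous.  'D_v is total, hence the explicit derivability clause. *)
Definition smooth f : Prop :=
  forall s : seq 'I_n,
    continuous (iter_partial s f) /\
    (forall (i : 'I_n) x, derivable (iter_partial s f) x (delta_mx 0 i)).

Definition convex_on_Rn f : Prop :=
  @convex_function R 'rV[R]_n [set: 'rV[R]_n] f.

End vectors.

Section probability.
Context {d : measure_display} {T : measurableType d} {R : realType}.
Implicit Type P : probability T R.

(* For Y >= 0; the conventions ln 0 = 0 and 0 * lne 0 = 0 give 0 log 0 = 0. *)
Definition Ent P (Y : T -> R) : \bar R :=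
  (if 'E_P[fun w => (Y w * ln (Y w))%R] < +oo
   then 'E_P[fun w => (Y w * ln (Y w))%R] - 'E_P[Y] * lne 'E_P[Y]
   else +oo)%E.

(* Taking some of the B i equal to setT gives the product rule for every
   subfamily. *)
Definition mutually_independent P (n : nat) (X : 'I_n -> {RV P >-> R}) : Prop :=
  forall B : 'I_n -> set R, (forall i, measurable (B i)) ->
    P [set w | forall i, B i (X i w)] =
    (\prod_(i < n) P (X i @^-1` B i))%E.

Definition random_vector P (n : nat) (X : 'I_n -> {RV P >-> R}) :
  T -> 'rV[R]_n := fun w => \row_i X i w.

End probability.

Section class_M.
Context {R : realType}.
Implicit Type mu : probability R R.

Definition nu_plus (beta m : R) mu (A : set R) : \bar R :=
  (\int[lebesgue_measure]_(x in (A `&` `[m, +oo[)%classic)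
     ((x `^ beta)%:E * mu `[x, +oo[%classic))%E.

Definition nu_minus (beta m : R) mu (A : set R) : \bar R :=
  (\int[lebesgue_measure]_(x in (A `&` `]-oo, (- m)%R])%classic)
     ((`|x| `^ beta)%:E * mu `]-oo, x]%classic))%E.

(* The last parameter is the whole constant of the tail inequalities; it is
   used with s = sigma `^ (beta + 1). *)
Definition class_M (beta m s : R) mu : Prop :=
  (forall x : R, m <= x ->
     (nu_plus beta m mu `[x, +oo[%classic <= s%:E * mu `[x, +oo[%classic)%E) /\
  (forall x : R, x <= - m ->
     (nu_minus beta m mu `]-oo, x]%classic <= s%:E * mu `]-oo, x]%classic)%E).

End class_M.

(* C is a constant in the modified log-Sobolev inequality for convex functions,
   valid in every dimension and on every probability space. *)
Definition mlsi_constant (R : realType) (beta m sigma C : R) : Prop :=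
  forall (n : nat) (d : measure_display) (T : measurableType d)
    (P : probability T R) (X : 'I_n -> {RV P >-> R}) (psi : 'rV[R]_n -> R),
  (0 < n)%N ->
  mutually_independent X ->
  (forall i, class_M beta m (sigma `^ (beta + 1)) (distribution P (X i))) ->
  smooth psi -> convex_on_Rn psi ->
  let Z := random_vector X in
  let Y := fun w => expR (psi (Z w)) in
  let p := (beta + 1) / beta in
  (0 < beta ->
     (Ent P Y <=
      C%:E * 'E_P[fun w =>
        (Num.max (lpnorm 2 (grad psi (Z w)) ^+ 2)
                 (lpnorm p (grad psi (Z w)) `^ p) * Y w)%R])%E) /\
  (beta = 0 ->
     (forall i x, `|partial i psi x| <= 1 / (2 * (m + 3 * sigma))) ->
     (Ent P Y <=
      C%:E * 'E_P[fun w => (lpnorm 2 (grad psi (Z w)) ^+ 2 * Y w)%R])%E).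

(* Main.v *)
Require Import Defs.
From HB Require Import structures.
From mathcomp Require Import all_boot all_order all_algebra.
From mathcomp Require Import all_classical all_reals all_analysis.
From mathcomp Require Import measurable_realfun.
From mathcomp Require Import ring lra.

(* Herbst's argument. Let psi be smooth and convex, with E psi(X) = 0 after
   centering, and f(s) = ln E exp(s psi(X)). The log-Sobolev inequality bounds
   the mean of s psi(X) under the law tilted by exp(s psi(X)) by f(s) + B s^2,
   and Jensen's inequality under that tilted law gives
     f(theta s) >= theta f(s) - (1 - theta) B s^2   for 0 < theta < 1.
   Hence A = sup f(s) / s^2 satisfies theta A <= B for every theta < 1, that is
   f(s) <= B s^2, without differentiating f.
   A convex Lipschitz phi is the pointwise limit of functions psi_k <= phi which
   are log-sum-exps of affine minorants of phi at rational points; these are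
   smooth and convex, and their gradients, being averages of subgradients of
   phi, inherit both dual Lipschitz bounds. Fatou's lemma transfers the
   exponential bound to phi, and the Chernoff bound is used at lam = M / (2 t),
   where M is the minimum in the exponent; this gives the constant 1/4 in both
   cases.
   The a priori finiteness of exp(lam |phi(X)|) comes from the geometric decay
   of the tails of laws in class_M, and from independence. *)

Import Order.TTheory GRing.Theory Num.Theory.
Import numFieldNormedType.Exports.

Local Open Scope classical_set_scope.
Local Open Scope ring_scope.

(** * Log-sum-exp functions *)

(** Herbst's argument runs with a purely quadratic bound [B * s ^+ 2], although for beta > 0 the
    log-Sobolev inequality also contains the power q = (beta + 1) / beta. Since beta <= 1 gives q >=
    2, the term (s L)^q is at most s^2 times lam^(q - 2) L^q for s <= lam. So B is allowed to depend
    on lam, and at s = lam nothing is lost. With lam = M / (2 t) the linear part of the Chernoff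
    exponent is M / 2, while B lam^2 is at most M / 4. Dominating s psi e^(s psi) costs exponential
    moments at the doubled rate 2 lam. For beta = 0 such moments exist in general only below a
    threshold: tails lose a factor 3 over a step m + 3 sigma, and e < 3, so rates up to 1 / (m + 3
    sigma) are allowed. The second term of the minimum M gives 2 lam L <= 1 / (m + 3 sigma), which
    yields at the same time the gradient restriction of the inequality for beta = 0. *)

Section dot.
Context {R : realType} {n : nat}.
Implicit Types a x y v : 'rV[R]_n.

Definition dot a x : R := \sum_(i < n) a 0 i * x 0 i.

Lemma dotDr a x y : dot a (x + y) = dot a x + dot a y.
Proof. by rewrite /dot -big_split /=; apply: eq_bigr => i _; rewrite mxE mulrDr. Qed.

Lemma dotZr a k x : dot a (k *: x) = k * dot a x.
Proof. by rewrite /dot mulr_sumr; apply: eq_bigr => i _; rewrite mxE mulrCA. Qed.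

Lemma dotBr a x y : dot a (x - y) = dot a x - dot a y.
Proof. by rewrite dotDr -scaleN1r dotZr mulN1r. Qed.

Lemma dot_delta a i : dot a (delta_mx 0 i) = a 0 i.
Proof.
rewrite /dot (bigD1 i) //= mxE !eqxx mulr1 big1 ?addr0 // => j ji.
by rewrite mxE eqxx (negbTE ji) mulr0.
Qed.

Lemma continuous_dot a : continuous (dot a).
Proof.
have c i : continuous (fun x : 'rV[R]_n => a 0 i * x 0 i).
  by move=> x; apply: (@cvgMl_tmp _ _ (nbhs x)); exact: coord_continuous.
by apply: continuous_big => [|i _]; [exact: add_continuous|exact: c].
Qed.

Lemma continuous_expR_affine a (b : R) :
  continuous (fun x => expR (dot a x + b)).
Proof.
move=> x; apply: (@continuous_comp _ _ _ (fun x => dot a x + b) expR).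
  apply: (@cvgD _ _ _ (nbhs x)); first exact: continuous_dot.
  exact: cvg_cst.
exact: continuous_expR.
Qed.

Lemma derive_along (f : 'rV[R]_n -> R) x v :
  'D_1 (fun h : R => f (h *: v + x)) 0 = 'D_v f x.
Proof.
rewrite /derive; set g := (X in lim (X @ _) = _).
suff <- : g = (fun h : R => h^-1 *: ((f \o shift x) (h *: v) - f x)) by [].
by apply/funext => h; rewrite /g /= addr0 scale0r add0r [_%:A]mulr1.
Qed.

Lemma is_derive_along (f : 'rV[R]_n -> R) x v df :
  is_derive (0 : R) 1 (fun h => f (h *: v + x)) df -> is_derive x v f df.
Proof.
move=> [der val]; split; first by apply/derivable1P.
by rewrite -derive_along.
Qed.

(** The one-variable chain rule is applied on the line [h *: v + x], so a derivative of [g] along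
    [v] suffices and Fréchet differentiability never enters. *)
Lemma is_derive_compR (f : R -> R) (g : 'rV[R]_n -> R) x v df dg :
  is_derive x v g dg -> is_derive (g x) 1 f df ->
  is_derive x v (f \o g) (df * dg).
Proof.
move=> [gder gval] fder; apply: is_derive_along.
apply: (@is_derive1_comp _ f (fun h => g (h *: v + x)) 0 df dg).
  by rewrite scale0r add0r.
by split; [exact: (derivable1P g x v).1|rewrite derive_along].
Qed.

Lemma is_derive_dot a x v : is_derive x v (dot a) (dot a v).
Proof.
apply: is_derive_along.
under eq_fun do rewrite dotDr dotZr.
have -> : (fun h => h * dot a v + dot a x) =
  ((fun h : R => h) * cst (dot a v)) + cst (dot a x) :> (R -> R).
  by apply/funext.
apply: is_derive_eq.
by rewrite scaler0 add0r addr0 [_%:A]mulr1.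
Qed.

End dot.

Section log_sum_exp.
Context {R : realType} {n N : nat}.
Variables (a : 'I_N.+1 -> 'rV[R]_n) (b : 'I_N.+1 -> R).
Implicit Types x y v : 'rV[R]_n.

Definition expsum x : R := \sum_j expR (dot (a j) x + b j).

(** Softmax weights. Being nonnegative with sum 1, they make the gradient of [lse] a multiple of an
    average of the slopes [a j], so that bounds on the slopes pass to the gradient. *)
Definition weight j x : R := expR (dot (a j) x + b j) / expsum x.

Definition lse (k c : R) x : R := k * ln (expsum x) + c.

Definition lse_grad (k : R) x : 'rV[R]_n := k *: \sum_j weight j x *: a j.

Lemma expsum_gt0 x : 0 < expsum x.
Proof.
rewrite /expsum (bigD1 ord0) //= ltr_pwDl ?expR_gt0 //.
by apply: sumr_ge0 => j _; exact: expR_ge0.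
Qed.

Lemma weight_ge0 j x : 0 <= weight j x.
Proof. by rewrite divr_ge0 ?expR_ge0 // ltW // expsum_gt0. Qed.

Lemma sum_weight x : \sum_j weight j x = 1.
Proof. by rewrite -mulr_suml divff // gt_eqF // expsum_gt0. Qed.

Lemma dot_lse_grad k x v :
  dot (lse_grad k x) v = k * \sum_j weight j x * dot (a j) v.
Proof.
rewrite /dot; under eq_bigr do rewrite mxE summxE -mulrA mulr_suml.
rewrite -mulr_sumr; congr (_ * _).
rewrite exchange_big /=; apply: eq_bigr => j _.
by rewrite mulr_sumr; apply: eq_bigr => i _; rewrite mxE mulrA.
Qed.

Lemma is_derive_expsum x v :
  is_derive x v expsum (\sum_j expR (dot (a j) x + b j) * dot (a j) v).
Proof.
have -> : expsum = \sum_j (fun x => expR (dot (a j) x + b j)).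
  by apply/funext => y; rewrite /expsum fct_sumE.
apply: is_derive_sum => j.
apply: (@is_derive_compR R n expR (fun x => dot (a j) x + b j)).
rewrite -[X in is_derive _ _ _ X]addr0.
exact: is_deriveD (is_derive_dot _ _ _) (is_derive_cst _ _ _).
Qed.

(** The derivative is put in a form without quotients: it is a polynomial in the weights, which is
    what closes [wpoly] under derivation. *)
Lemma is_derive_weight j x v :
  is_derive x v (weight j)
    (weight j x * (dot (a j) v - \sum_i weight i x * dot (a i) v)).
Proof.
have S0 : expsum x != 0 by rewrite gt_eqF // expsum_gt0.
have dinv : is_derive x v (fun y => (expsum y)^-1)
    (- (expsum x) ^- 2 *: (\sum_j expR (dot (a j) x + b j) * dot (a j) v)).
  have [der val] := is_derive_expsum x v.
  by split; [exact: derivableV|rewrite deriveV // val].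
have dexp : is_derive x v (fun x => expR (dot (a j) x + b j))
    (expR (dot (a j) x + b j) * dot (a j) v).
  apply: (@is_derive_compR R n expR (fun x => dot (a j) x + b j)).
  rewrite -[X in is_derive _ _ _ X]addr0.
  exact: is_deriveD (is_derive_dot _ _ _) (is_derive_cst _ _ _).
apply: (is_derive_eq (is_deriveM dexp dinv)).
rewrite /weight.
have -> : \sum_i expR (dot (a i) x + b i) / expsum x * dot (a i) v =
    (\sum_i expR (dot (a i) x + b i) * dot (a i) v) / expsum x.
  by rewrite mulr_suml; apply: eq_bigr => i _; rewrite mulrAC.
rewrite /GRing.scale /=; field.
by rewrite S0.
Qed.

Lemma is_derive_lse k c x v :
  is_derive x v (lse k c) (dot (lse_grad k x) v).
Proof.
have dln : is_derive x v (@ln R \o expsum)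
    ((expsum x)^-1 * \sum_j expR (dot (a j) x + b j) * dot (a j) v).
  apply: is_derive_compR; first exact: is_derive_expsum.
  by apply: is_derive1_ln; exact: expsum_gt0.
have -> : lse k c = k *: (@ln R \o expsum) + cst c by apply/funext.
apply: (is_derive_eq (is_deriveD (is_deriveZ k dln) (is_derive_cst _ _ _))).
rewrite addr0 dot_lse_grad; congr (k * _).
by rewrite mulr_sumr; apply: eq_bigr => j _; rewrite mulrA [_^-1 * _]mulrC.
Qed.

Lemma partial_lse k c i x : partial i (lse k c) x = lse_grad k x 0 i.
Proof.
by rewrite /partial (derive_val (is_derive := is_derive_lse k c x _)) dot_delta.
Qed.

Lemma grad_lse k c x : grad (lse k c) x = lse_grad k x.
Proof. by apply/rowP => i; rewrite mxE partial_lse. Qed.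

Lemma continuous_expsum : continuous expsum.
Proof.
apply: continuous_big => [|j _]; first exact: add_continuous.
exact: continuous_expR_affine.
Qed.

Lemma continuous_weight j : continuous (weight j).
Proof.
move=> x; apply: (@cvgM _ _ (nbhs x)); first exact: continuous_expR_affine.
apply: (@cvgV _ _ (nbhs x)); first by rewrite gt_eqF // expsum_gt0.
exact: continuous_expsum.
Qed.

Lemma continuous_lse k c : continuous (lse k c).
Proof.
move=> x; apply: (@cvgD _ _ _ (nbhs x)); last exact: cvg_cst.
have cln : {for expsum x, continuous (@ln R)}.
  by apply: continuous_ln; exact: expsum_gt0.
exact: (@cvgMl_tmp _ _ (nbhs x) _ _ _ _
  (continuous_comp (continuous_expsum x) cln)).
Qed.

(* Polynomials in the softmax weights: this algebra is stable under partial
   derivatives, which gives smoothness at every order. *)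
Inductive wpoly : ('rV[R]_n -> R) -> Prop :=
| wpoly_cst r : wpoly (cst r)
| wpoly_weight j : wpoly (weight j)
| wpolyD f g : wpoly f -> wpoly g -> wpoly (f + g)
| wpolyM f g : wpoly f -> wpoly g -> wpoly (f * g).

Lemma wpoly_sum (I : Type) (s : seq I) (F : I -> 'rV[R]_n -> R) :
  (forall i, wpoly (F i)) -> wpoly (fun x => \sum_(i <- s) F i x).
Proof.
move=> wF; have -> : (fun x => \sum_(i <- s) F i x) = \sum_(i <- s) F i.
  by apply/funext => x; rewrite fct_sumE.
elim/big_ind: _ => [|f g|i _]; [exact: (wpoly_cst 0)|exact: wpolyD|exact: wF].
Qed.

Lemma wpoly_continuous f : wpoly f -> continuous f.
Proof.
elim=> [r|j|g h _ cg _ ch|g h _ cg _ ch] x.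
- exact: cst_continuous.
- exact: continuous_weight.
- by apply: (@cvgD _ _ _ (nbhs x)); [exact: cg|exact: ch].
- by apply: (@cvgM _ _ (nbhs x)); [exact: cg|exact: ch].
Qed.

Lemma wpoly_derive f v : wpoly f ->
  exists2 g, wpoly g & forall x, is_derive x v f (g x).
Proof.
elim=> [r|j|g h wg [g' wg' dg] wh [h' wh' dh]|g h wg [g' wg' dg] wh [h' wh' dh]].
- by exists (cst 0); [exact: wpoly_cst|move=> x; exact: is_derive_cst].
- exists (weight j * (cst (dot (a j) v) +
    cst (-1) * (fun x => \sum_i (weight i * cst (dot (a i) v)) x))).
    apply: wpolyM; first exact: wpoly_weight.
    apply: wpolyD; first exact: wpoly_cst.
    apply: wpolyM; first exact: wpoly_cst.
    apply: wpoly_sum => i; apply: wpolyM; [exact: wpoly_weight|exact: wpoly_cst].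
  by move=> x; apply: (is_derive_eq (is_derive_weight j x v)); rewrite !fctE mulN1r.
- by exists (g' + h'); [exact: wpolyD|move=> x; exact: is_deriveD].
- exists (g * h' + h * g'); first by apply: wpolyD; exact: wpolyM.
  by move=> x; apply: (is_derive_eq (is_deriveM (dg x) (dh x))).
Qed.

Lemma wpoly_partial f i : wpoly f -> wpoly (partial i f).
Proof.
move=> /(wpoly_derive _ (delta_mx 0 i))[g wg dg].
suff -> : partial i f = g by [].
by apply/funext => x; rewrite /partial (derive_val (is_derive := dg x)).
Qed.

Lemma smooth_lse k c : smooth (lse k c).
Proof.
have wp i : wpoly (partial i (lse k c)).
  have -> : partial i (lse k c) =
      fun x => \sum_j (cst k * (weight j * cst (a j 0 i))) x.
    apply/funext => x; rewrite partial_lse -dot_delta dot_lse_grad mulr_sumr.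
    by apply: eq_bigr => j _; rewrite dot_delta.
  apply: wpoly_sum => j; apply: wpolyM; first exact: wpoly_cst.
  by apply: wpolyM; [exact: wpoly_weight|exact: wpoly_cst].
(* [lse] itself, a logarithm, need not be a polynomial in the weights; its first partial derivatives
   are. Hence order zero is treated apart. *)
have it s : s != [::] -> wpoly (iter_partial s (lse k c)).
  by elim: s => // i [|j s] ih _ //=; apply: wpoly_partial; exact: ih.
case=> [|i s]; split.
- exact: continuous_lse.
- by move=> i x /=; have [] := is_derive_lse k c x (delta_mx 0 i).
- exact/wpoly_continuous/it.
- move=> j x; have [g _ dg] := wpoly_derive _ (delta_mx 0 j) (it (i :: s) isT).
  by have [] := dg x.
Qed.

(** The quotient of [expsum y] by [expsum x] is the mean of [expR (dot (a j) (y - x))] under the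
    weights at [x], and Jensen's inequality bounds it from below. Both the convexity of [lse] and
    its Lipschitz bound rest on this inequality. *)
Lemma lse_tangent k c x y : 0 <= k ->
  lse k c x + dot (lse_grad k x) (y - x) <= lse k c y.
Proof.
move=> k0; rewrite dot_lse_grad /lse addrAC lerD2r -mulrDr ler_wpM2l //.
set u := \sum_j _.
suff h : expsum x * expR u <= expsum y.
  rewrite -[u]expRK -lnM ?posrE ?expR_gt0 ?expsum_gt0 //.
  by rewrite ler_ln ?posrE ?mulr_gt0 ?expR_gt0 ?expsum_gt0.
rewrite -ler_pdivlMl ?expsum_gt0 // mulrC.
(* Jensen for exp, from the tangent line of exp at the average u *)
apply: (@le_trans _ _
  (\sum_j weight j x * (expR u * (1 + (dot (a j) (y - x) - u))))).
  have -> : \sum_j weight j x * (expR u * (1 + (dot (a j) (y - x) - u))) =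
      expR u * ((1 - u) * \sum_j weight j x +
                \sum_j weight j x * dot (a j) (y - x)).
    rewrite !mulr_sumr -big_split mulr_sumr /=.
    by apply: eq_bigr => j _; ring.
  by rewrite sum_weight -/u mulr1 subrK mulr1.
rewrite mulr_suml; apply: ler_sum => j _.
apply: (@le_trans _ _ (weight j x * expR (dot (a j) (y - x)))).
  rewrite ler_wpM2l ?weight_ge0 // -ler_pdivlMl ?expR_gt0 // mulrC -expRB.
  exact: expR_ge1Dx.
rewrite /weight mulrAC -expRD dotBr.
by rewrite (_ : _ + _ = dot (a j) y + b j) //; ring.
Qed.

(** The tangent at the barycentre [z] is compared with the values at [x] and [y]; in the average the
    linear terms cancel. *)
Lemma convex_lse k c : 0 <= k -> convex_on_Rn (lse k c).
Proof.
move=> k0 t x y _ _.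
pose z := (t%:num : R) *: x + (1 - t%:num) *: y.
rewrite [leLHS](_ : _ = lse k c z) // [leRHS]convRE.
have hx := lse_tangent k c z x k0; have hy := lse_tangent k c z y k0.
have t0 : 0 <= t%:num :> R by [].
have t1 : 0 <= (1 - t%:num : R) by rewrite subr_ge0.
have hx' := ler_wpM2l t0 hx; have hy' := ler_wpM2l t1 hy.
apply: le_trans (lerD hx' hy').
rewrite [leRHS](_ : _ = lse k c z +
  (t%:num * dot (lse_grad k z) (x - z) + (1 - t%:num) * dot (lse_grad k z) (y - z))).
  rewrite -!dotZr -dotDr [_ *: _ + _](_ : _ = 0).
    by rewrite -(scale0r (0 : 'rV[R]_n)) dotZr mul0r addr0.
  by apply/rowP => i; rewrite !mxE; ring.
by ring.
Qed.

End log_sum_exp.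

(** * Subgradients of convex functions *)

Section subgradient.
Context {R : realType} {n : nat}.
Implicit Types (p q : 'rV[R]_n -> R) (x y v e : 'rV[R]_n).

(** One inequality for homogeneity is enough to check; applied to the inverse factor it gives
    equality, see [sublinearZ]. *)
Definition sublinear p := (forall x y, p (x + y) <= p x + p y) /\
  (forall t x, 0 < t -> p (t *: x) <= t * p x).

Lemma sublinearZ p t x : sublinear p -> 0 < t -> p (t *: x) = t * p x.
Proof.
move=> [_ pZ] t0; apply/eqP; rewrite eq_le pZ //=.
have := pZ t^-1 (t *: x); rewrite invr_gt0 => /(_ t0).
by rewrite scalerA mulVf ?gt_eqF // scale1r ler_pdivlMl.
Qed.

Lemma sublinear0 p : sublinear p -> p 0 = 0.
Proof.
by move=> sp; have := sublinearZ p 2 0 sp (ltr0Sn _ _); rewrite scaler0; lra.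
Qed.

Lemma sublinear_ge p v : sublinear p -> - p (- v) <= p v.
Proof. by move=> sp; have := sp.1 v (- v); rewrite subrr sublinear0 //; lra. Qed.

(* q is the directional derivative of p at e. *)
Lemma sublinear_step p e : sublinear p -> exists q, [/\ sublinear q,
  forall v, q v <= p v & q (- e) = - q e].
Proof.
move=> sp.
(* By homogeneity this is the difference quotient (p (e + r v) - p e) / r with s = 1 / r. The value
   s = 0 gives p v, hence [q v <= p v]; s = 1 with v = - e gives - p e. *)
pose F v s := p (v + s *: e) - s * p e.
pose q v := inf [set F v s | s in [set s | 0 <= s]].
have Fge v s : 0 <= s -> - p (- v) <= F v s.
  rewrite le_eqVlt => /predU1P[<-|s0]; rewrite /F.
    by rewrite scale0r addr0 mul0r subr0 sublinear_ge.
  have := sp.1 (v + s *: e) (- v); rewrite addrAC subrr add0r.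
  by rewrite (sublinearZ _ _ _ sp s0); lra.
have F0 v : [set F v s | s in [set s | 0 <= s]] !=set0.
  by exists (F v 0), 0 => //=.
have Flb v : has_lbound [set F v s | s in [set s | 0 <= s]].
  by exists (- p (- v)) => _ [s s0 <-]; exact: Fge.
have qF v s : 0 <= s -> q v <= F v s.
  by move=> s0; apply: ge_inf; [exact: Flb|exists s].
have qge v r : (forall s, 0 <= s -> r <= F v s) -> r <= q v.
  by move=> h; apply: lb_le_inf; [exact: F0|move=> _ [s s0 <-]; exact: h].
have qp v : q v <= p v.
  by apply: le_trans (qF v 0 (lexx 0)) _; rewrite /F scale0r addr0 mul0r subr0.
have sq : sublinear q.
  split=> [x y|t x t0].
    rewrite -lerBlDr; apply: (qge _ _) => s s0;
      rewrite lerBlDr [X in _ <= X]addrC -lerBlDr.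
    apply: (qge _ _) => r r0; rewrite lerBlDr.
    have sr : 0 <= r + s by rewrite addr_ge0.
    apply: le_trans (qF (x + y) _ sr) _; rewrite /F.
    have := sp.1 (y + r *: e) (x + s *: e).
    rewrite (_ : y + r *: e + (x + s *: e) = x + y + (r + s) *: e); first lra.
    by apply/rowP => i; rewrite !mxE; ring.
  rewrite -ler_pdivrMl //; apply: (qge _ _) => s s0; rewrite ler_pdivrMl //.
  have ts : 0 <= t * s by rewrite mulr_ge0 // ltW.
  apply: le_trans (qF (t *: x) _ ts) _; rewrite /F.
  by rewrite -scalerA -scalerDr (sublinearZ _ _ _ sp t0); lra.
exists q; split=> //; apply/eqP; rewrite eq_le; apply/andP; split.
  apply: (@le_trans _ _ (- p e)); last by rewrite lerN2.
  apply: le_trans (qF (- e) 1 ler01) _.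
  by rewrite /F scale1r addNr sublinear0 // mul1r sub0r.
rewrite -[X in - q X](opprK e); exact: sublinear_ge.
Qed.

(** A new direction does not spoil the earlier ones: if r <= q and q (- f) = - q f, then r f <= q f
    = - q (- f) <= - r (- f) <= r f. *)
Lemma sublinear_steps p (s : seq 'rV[R]_n) : sublinear p ->
  exists q, [/\ sublinear q, forall v, q v <= p v &
    {in s, forall e, q (- e) = - q e}].
Proof.
move=> sp; elim: s => [|e s [q [sq qp qs]]]; first by exists p.
have [r [sr rq re]] := sublinear_step q e sq.
exists r; split=> // [v|f]; first exact: le_trans (rq v) (qp v).
rewrite inE => /predU1P[->//|fs]; apply/eqP; rewrite eq_le.
have h1 := sublinear_ge r f sr; have h2 := sublinear_ge r (- f) sr.
have h3 := rq f; have h4 := rq (- f); have h5 := qs _ fs.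
by rewrite opprK in h2; apply/andP; split; lra.
Qed.

(** Hahn-Banach in finite dimension. Once q <= p is odd along the basis, subadditivity gives q v <=
    dot a v; the same at - v, with - q (- v) <= q v, gives the converse inequality. *)
Lemma sublinear_dominates p : sublinear p -> exists a, forall v, dot a v <= p v.
Proof.
move=> sp.
have [q [sq qp qe]] :=
  sublinear_steps p [seq delta_mx 0 i | i : 'I_n] sp.
pose a : 'rV[R]_n := \row_i q (delta_mx 0 i).
have qZ i (t : R) : q (t *: delta_mx 0 i) = t * q (delta_mx 0 i).
  have [t0|t0|->] := ltgtP t 0.
  - rewrite -[t]opprK scaleNr -scalerN sublinearZ ?oppr_gt0 //.
    by rewrite qe ?mulrN ?mulNr // map_f // mem_enum.
  - by rewrite sublinearZ.
  - by rewrite scale0r mul0r sublinear0.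
have qle v : q v <= dot a v.
  rewrite [in leLHS](row_sum_delta v) /dot.
  elim/big_ind2: _ => [|x1 x2 y1 y2 h1 h2|i _].
  - by rewrite sublinear0.
  - by apply: le_trans (sq.1 _ _) _; exact: lerD.
  - by rewrite qZ mxE mulrC.
exists a => v; apply: le_trans (qp v).
have h1 := sublinear_ge q v sq; have h2 := qle (- v).
have : dot a (- v) = - dot a v by rewrite -scaleN1r dotZr mulN1r.
lra.
Qed.

Lemma convex_onP (f : 'rV[R]_n -> R) x y s t : convex_on_Rn f ->
  0 <= s -> 0 <= t -> s + t = 1 -> f (s *: x + t *: y) <= s * f x + t * f y.
Proof.
move=> cf s0 t0 st; have s1 : s <= 1 by lra.
have -> : t = 1 - s by lra.
have := cf (Itv01 s0 s1) x y; rewrite !inE; apply=> //.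
Qed.

Lemma convex_subgradient (f : 'rV[R]_n -> R) x : convex_on_Rn f ->
  exists a, forall y, f x + dot a (y - x) <= f y.
Proof.
move=> cf.
pose F v t := (f (x + t *: v) - f x) / t.
pose p v := inf [set F v t | t in [set t | 0 < t]].
have F0 v : [set F v s | s in [set s | 0 < s]] !=set0.
  by exists (F v 1), 1 => //=.
have Flb v : has_lbound [set F v s | s in [set s | 0 < s]].
  (* [x] is the combination of [x + t *: v] and [x - v] with weights 1 / (1 + t) and t / (1 + t). *)
  exists (f x - f (x - v)) => _ [t /= t0 <-]; rewrite /F ler_pdivlMr //.
  have t1 : 0 < 1 + t by lra.
  have st : (1 + t)^-1 + t / (1 + t) = 1 by field; rewrite gt_eqF.
  have i0 : 0 <= (1 + t)^-1 by rewrite invr_ge0 ltW.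
  have j0 : 0 <= t / (1 + t) by rewrite divr_ge0 // ltW.
  have := convex_onP f (x + t *: v) (x - v) _ _ cf i0 j0 st.
  rewrite (_ : _ *: _ + _ = x); last first.
    by apply/rowP => i; rewrite !mxE; field; rewrite gt_eqF.
  move=> /(ler_wpM2l (ltW t1)).
  rewrite [X in _ <= X -> _](_ : _ = f (x + t *: v) + t * f (x - v)); first lra.
  by field; rewrite gt_eqF.
have pF v t : 0 < t -> p v <= F v t.
  by move=> t0; apply: ge_inf; [exact: Flb|exists t].
have pge v r : (forall t, 0 < t -> r <= F v t) -> r <= p v.
  by move=> h; apply: lb_le_inf; [exact: F0|move=> _ [t t0 <-]; exact: h].
have sp : sublinear p.
  split=> [u v|c v c0].
    rewrite -lerBlDr; apply: (pge _ _) => s s0;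
      rewrite lerBlDr [X in _ <= X]addrC -lerBlDr.
    apply: (pge _ _) => t t0; rewrite lerBlDr.
    have st : 0 < s + t by rewrite addr_gt0.
    (* This step length makes [x + r *: (u + v)] a convex combination of [x + s *: u] and
       [x + t *: v], with weights t / (s + t) and s / (s + t). *)
    have r0 : 0 < s * t / (s + t) by rewrite divr_gt0 // mulr_gt0.
    apply: le_trans (pF (u + v) _ r0) _; rewrite /F ler_pdivrMr //.
    have e1 : t / (s + t) + s / (s + t) = 1 by field; rewrite gt_eqF.
    have i0 : 0 <= t / (s + t) by rewrite divr_ge0 // ltW.
    have j0 : 0 <= s / (s + t) by rewrite divr_ge0 // ltW.
    have := convex_onP f (x + s *: u) (x + t *: v) _ _ cf i0 j0 e1.
    rewrite (_ : _ *: _ + _ = x + (s * t / (s + t)) *: (u + v)); last first.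
      by apply/rowP => i; rewrite !mxE; field; rewrite gt_eqF.
    move=> h; rewrite lerBlDr; apply: le_trans h _.
    rewrite le_eqVlt; apply/orP; left; apply/eqP; field.
    by rewrite !gt_eqF.
  rewrite -ler_pdivrMl //; apply: (pge _ _) => t t0; rewrite ler_pdivrMl //.
  have tc : 0 < t / c by rewrite divr_gt0.
  apply: le_trans (pF (c *: v) _ tc) _; rewrite /F scalerA divfK ?gt_eqF //.
  by rewrite invf_div mulrA mulrAC mulrC mulrA.
have [a ap] := sublinear_dominates p sp.
exists a => y; rewrite addrC -lerBrDr; apply: le_trans (ap _) _.
apply: le_trans (pF _ _ ltr01) _.
by rewrite /F scale1r divr1 [x + _]addrC subrK.
Qed.

End subgradient.

(** * Exponential moments *)

Section independent_product.
Context {d : measure_display} {T : measurableType d} {R : realType}.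
Context {P : probability T R} {n : nat}.
Variable X : 'I_n -> {RV P >-> R}.
Implicit Type h : 'I_n -> R -> R.

Definition subproduct h : Prop :=
  (\int[P]_w (\prod_(i < n) h i (X i w))%:E <=
   \prod_(i < n) \int[P]_w (h i (X i w))%:E)%E.

Lemma measurable_RV_preimage i B : measurable B -> measurable (X i @^-1` B).
Proof. by move=> mB; rewrite -[_ @^-1` _]setTI; exact: measurable_funPT. Qed.

Lemma subproduct_indic (B : 'I_n -> set R) : mutually_independent X ->
  (forall i, measurable (B i)) -> subproduct (fun i => \1_(B i)).
Proof.
move=> indX mB; rewrite /subproduct.
have mD : measurable [set w | forall i, B i (X i w)].
  rewrite (_ : mkset _ = \bigcap_(i in [set: 'I_n]) (X i @^-1` B i)); last first.
    by apply/seteqP; split=> [w h i _|w h i]; [exact: h|exact: h].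
  by apply: fin_bigcap_measurable => // i _; exact: measurable_RV_preimage.
rewrite (_ : (fun w => _) =
    (fun w => (\1_[set w | forall i, B i (X i w)] w)%:E)); last first.
  apply/funext => w; congr EFin.
  have [h|/existsNP[i nh]] := pselect (forall i, B i (X i w)).
    rewrite indicE mem_set // big1 // => i _.
    by rewrite indicE mem_set.
  rewrite indicE memNset; last by apply/existsNP; exists i.
  by rewrite (bigD1 i) //= indicE memNset // mul0r.
rewrite integral_indic // setIT [leLHS](indX B mB) le_eqVlt; apply/orP; left; apply/eqP.
apply: eq_bigr => i _.
by rewrite -[RHS]/(\int[P]_w (\1_(X i @^-1` B i) w)%:E)%E integral_indic ?setIT //;
  exact: measurable_RV_preimage.
Qed.

(** Where [kap (X j)] equals k the factor of index j is the constant [c k]. Both sides are therefore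
    series in k of [c k] times the two sides of the indicator case, and are compared termwise.
    Countably many levels take the place of a product measure. *)
Lemma subproduct_level h (j : 'I_n) (kap : R -> nat) (c : nat -> R) :
  (forall i x, 0 <= h i x) -> (forall i, measurable_fun [set: R] (h i)) ->
  (forall i, (\int[P]_w (h i (X i w))%:E < +oo)%E) ->
  (forall k, 0 <= c k) -> (forall k, measurable (kap @^-1` [set k])) ->
  measurable_fun [set: R] (c \o kap) ->
  (forall k, subproduct
    (fun i => if i == j then \1_(kap @^-1` [set k]) else h i)) ->
  subproduct (fun i => if i == j then c \o kap else h i).
Proof.
move=> h0 mh hfin c0 mk mck sub.
pose H w := \prod_(i < n | i != j) h i (X i w).
pose Q := \prod_(i < n | i != j) fine (\int[P]_w (h i (X i w))%:E)%E.
have hX i : measurable_fun [set: T] (fun w => h i (X i w)).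
  exact: measurableT_comp.
have H0 w : 0 <= H w by apply: prodr_ge0.
have mH : measurable_fun [set: T] H.
  rewrite (_ : H = fun w => \prod_(i < n) if i != j then h i (X i w) else 1).
    by apply: measurable_prod => i _; case: (i != j).
  by apply/funext => w; rewrite /H [LHS]big_mkcond.
have Q0 : 0 <= Q.
  apply: prodr_ge0 => i _; apply: fine_ge0; apply: integral_ge0 => w _.
  by rewrite lee_fin.
have QE : (\prod_(i < n | i != j) \int[P]_w (h i (X i w))%:E = Q%:E)%E.
  rewrite -prodEFin; apply: eq_bigr => i _; rewrite fineK // ge0_fin_numE //.
  by apply: integral_ge0 => w _; rewrite lee_fin.
have split_j (f : R -> R) w :
    \prod_(i < n) (if i == j then f else h i) (X i w) = f (X j w) * H w.
  rewrite (bigD1 j) //= eqxx; congr (_ * _).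
  by apply: eq_bigr => i /negbTE ->.
have splitE (f : R -> R) :
    (\prod_(i < n) \int[P]_w ((if i == j then f else h i) (X i w))%:E =
     \int[P]_w (f (X j w))%:E * Q%:E)%E.
  rewrite (bigD1 j) //= eqxx -QE; congr (_ * _)%E.
  by apply: eq_bigr => i /negbTE ->.
pose F k := X j @^-1` (kap @^-1` [set k]).
have mF k : measurable (F k) by exact: measurable_RV_preimage.
have FT : \bigcup_k F k = [set: T].
  by apply/seteqP; split=> // w _; exists (kap (X j w)).
have tF : trivIset [set: nat] F.
  by move=> k l _ _ [w [/= <- <-]].
have layers (f : T -> R) : measurable_fun [set: T] f -> (forall w, 0 <= f w) ->
    (\int[P]_w (c (kap (X j w)) * f w)%:E =
     \sum_(0 <= k <oo) (c k)%:E * \int[P]_w (\1_(F k) w * f w)%:E)%E.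
  move=> mf f0; rewrite -[in LHS]FT ge0_integral_bigcup //; first last.
  - by move=> w _; rewrite lee_fin mulr_ge0.
  - rewrite FT; apply/measurable_EFinP/measurable_funM => //.
    exact: (measurableT_comp mck).
  apply: eq_eseriesr => k _.
  rewrite -ge0_integralZl_EFin //; first last.
  - by apply/measurable_EFinP/measurable_funM => //; exact: measurable_indic.
  - by move=> w _; rewrite lee_fin mulr_ge0.
  rewrite integral_mkcond; apply: eq_integral => w _.
  rewrite patchE indicE; case: ifPn => [|_].
    by rewrite inE /F /= => ->; rewrite mul1r.
  by rewrite mul0r mule0.
rewrite /subproduct splitE.
under eq_integral do rewrite split_j /=.
rewrite layers //.
under [X in (_ <= X * _)%E]eq_integral do rewrite -[(_ \o _) _]mulr1.
rewrite (layers (cst 1)) //.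
rewrite muleC -nneseriesZl; last first.
  move=> k _; rewrite mule_ge0 ?lee_fin //; apply: integral_ge0 => w _.
  by rewrite lee_fin mulr1.
apply: lee_nneseries => [k _ _|k _].
  rewrite mule_ge0 ?lee_fin //; apply: integral_ge0 => w _.
  by rewrite lee_fin mulr_ge0.
rewrite muleCA; apply: lee_wpmul2l; first by rewrite lee_fin.
have := sub k; rewrite /subproduct splitE muleC.
under eq_integral do rewrite split_j.
by under [X in (_ <= _ * X)%E -> _]eq_integral do rewrite -[\1__ _]mulr1.
Qed.

(* The indicators of subproduct_indic are replaced, one coordinate at a time, by
   the step function c \o kap. *)
Lemma independent_product (kap : R -> nat) (c : nat -> R) :
  mutually_independent X -> (forall k, 0 <= c k) ->
  (forall k, measurable (kap @^-1` [set k])) ->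
  measurable_fun [set: R] (c \o kap) ->
  (forall i, (\int[P]_w (c (kap (X i w)))%:E < +oo)%E) ->
  (\int[P]_w (\prod_(i < n) c (kap (X i w)))%:E < +oo)%E.
Proof.
move=> indX c0 mk mck fin.
have sub (s : seq 'I_n) : forall B : 'I_n -> set R, (forall i, measurable (B i)) ->
    subproduct (fun i => if i \in s then c \o kap else \1_(B i)).
  elim: s => [|j s ih] B mB; first exact: subproduct_indic.
  have [js|js] := boolP (j \in s).
    rewrite (_ : (fun i => _) = (fun i => if i \in s then c \o kap else \1_(B i))).
      exact: ih.
    by apply/funext => i; rewrite inE; case: eqP => // ->; rewrite js.
  pose h i := if i \in s then c \o kap else \1_(B i).
  rewrite (_ : (fun i => _) = (fun i => if i == j then c \o kap else h i)); last first.
    by apply/funext => i; rewrite inE; case: eqP.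
  apply: subproduct_level => //.
  - by move=> i x; rewrite /h; case: ifP => // _; rewrite /= ?c0.
  - by move=> i; rewrite /h; case: ifP => // _; exact: measurable_indic.
  - move=> i; rewrite /h; case: ifP => _; first exact: fin.
    rewrite -[X in (X < _)%E]/(\int[P]_w (\1_(X i @^-1` B i) w)%:E)%E.
    rewrite integral_indic //; last exact: measurable_RV_preimage.
    by rewrite setIT (le_lt_trans (probability_le1 _ _)) ?ltry //;
      exact: measurable_RV_preimage.
  - move=> k.
    rewrite (_ : (fun i => _) = (fun i => if i \in s then c \o kap else
        \1_(if i == j then kap @^-1` [set k] else B i))); last first.
      apply/funext => i; rewrite /h; case: (eqVneq i j) => [->|//].
      by rewrite (negbTE js).
    by apply: ih => i; case: ifP.
have := sub (enum 'I_n) (fun _ => setT) (fun _ => measurableT).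
rewrite /subproduct.
under eq_integral do under eq_bigr do rewrite mem_enum /=.
under eq_bigr do under eq_integral do rewrite mem_enum /=.
move=> /le_lt_trans; apply; rewrite ltey_eq prode_fin_num // => i _.
by rewrite ge0_fin_numE //; apply: integral_ge0 => w _; rewrite lee_fin.
Qed.

End independent_product.

(** * Geometric decay of tails from the inequalities defining [class_M] *)

Section class_M_tails.
Context {R : realType}.
Implicit Types (mu : probability R R) (beta m s a x : R).

Lemma ge0_integral_ge_itv (f : R -> R) (D : set R) (u a c : R) :
  measurable D -> measurable_fun D f -> (forall x, D x -> 0 <= f x) ->
  0 < a -> 0 <= c -> `[u, u + a]%classic `<=` D ->
  (forall x, u <= x <= u + a -> c <= f x) ->
  ((c * a)%:E <= \int[lebesgue_measure]_(x in D) (f x)%:E)%E.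
Proof.
move=> mD mf f0 a0 c0 sub cf.
have mf' : measurable_fun D (EFin \o f) by exact/measurable_EFinP.
have f0' x : D x -> (0 <= (f x)%:E)%E by move=> /f0; rewrite lee_fin.
refine (le_trans _ (ge0_subset_integral lebesgue_measure
  (measurable_itv `[u, u + a]) mD mf' f0' sub)).
rewrite (_ : (c * a)%:E = \int[lebesgue_measure]_(x in `[u, (u + a)%R]) cst c%:E x)%E.
  apply: ge0_le_integral => //.
  - exact: (measurable_funS mD sub mf').
rewrite integral_cst //= lebesgue_measure_itv /= lte_fin ltrDl a0.
by rewrite -EFinB -EFinM addrAC subrr add0r.
Qed.

Lemma fine_measureK mu (A : set R) : measurable A -> (fine (mu A))%:E = mu A.
Proof. by move=> mA; rewrite fineK // fin_num_measure. Qed.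

Lemma le_fine_measure mu (A B : set R) : measurable A -> measurable B ->
  A `<=` B -> fine (mu A) <= fine (mu B).
Proof.
by move=> mA mB AB; rewrite -lee_fin !fine_measureK //; apply: le_measure;
  rewrite ?inE.
Qed.

(** The integral is cut down to the interval from x to x + a, where the density is at least x^beta
    times the mass beyond x + a. *)
Lemma class_M_right beta m s mu x a : 0 <= beta -> 0 < m -> class_M beta m s mu ->
  m <= x -> 0 < a ->
  a * x `^ beta * fine (mu `[x + a, +oo[%classic) <=
  s * fine (mu `[x, +oo[%classic).
Proof.
move=> b0 m0 [+ _] mx a0; have x0 : 0 < x by apply: lt_le_trans mx.
move=> /(_ x mx); rewrite /nu_plus -fine_measureK // => h.
rewrite -lee_fin [leRHS]EFinM; apply: le_trans h.
rewrite (_ : `[x, +oo[ `&` `[m, +oo[ = `[x, +oo[)%classic; last first.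
  apply: setIidl => y /=; rewrite !in_itv /= !andbT; exact: le_trans.
pose G y := fine (mu `[y, +oo[%classic).
under eq_integral do rewrite -fine_measureK // -EFinM -/(G _).
rewrite -/(G _) -[leLHS]/((a * x `^ beta * G (x + a))%:E).
rewrite -mulrA mulrC.
have Ganti y z : y <= z -> G z <= G y.
  move=> yz; apply: le_fine_measure => // t /=; rewrite !in_itv /= !andbT.
  exact: le_trans.
have G0 y : 0 <= G y by exact: fine_ge0.
apply: (ge0_integral_ge_itv _ _ x) => //.
- apply: measurable_funTS; apply: measurable_funM; first exact: measurable_powR.
  exact: nonincreasing_measurable.
- by move=> y _; rewrite mulr_ge0 ?powR_ge0.
- by rewrite mulr_ge0 ?powR_ge0.
- by move=> y /=; rewrite !in_itv /= andbT => /andP[].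
- move=> y /andP[xy yxa]; rewrite ler_pM ?powR_ge0 // ?Ganti //.
  by rewrite ge0_ler_powR // nnegrE ltW // (lt_le_trans x0).
Qed.

Lemma class_M_left beta m s mu x a : 0 <= beta -> 0 < m -> class_M beta m s mu ->
  m <= x -> 0 < a ->
  a * x `^ beta * fine (mu `]-oo, - (x + a)]%classic) <=
  s * fine (mu `]-oo, - x]%classic).
Proof.
move=> b0 m0 [_ +] mx a0; have x0 : 0 < x by apply: lt_le_trans mx.
move=> /(_ (- x)); rewrite lerN2 => /(_ mx).
rewrite /nu_minus -fine_measureK // => h.
rewrite -lee_fin [leRHS]EFinM; apply: le_trans h.
rewrite (_ : `]-oo, (- x)%R] `&` `]-oo, (- m)%R] = `]-oo, (- x)%R])%classic; last first.
  apply: setIidl => y /=; rewrite !in_itv /= => yx.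
  by rewrite (le_trans yx) // lerN2.
pose G y := fine (mu `]-oo, y]%classic).
under eq_integral do rewrite -fine_measureK // -EFinM -/(G _).
rewrite -/(G _) -[leLHS]/((a * x `^ beta * G (- (x + a)))%:E).
rewrite -mulrA mulrC.
have Gmono y z : y <= z -> G y <= G z.
  move=> yz; apply: le_fine_measure => // t /=; rewrite !in_itv /= => ty.
  exact: le_trans yz.
have G0 y : 0 <= G y by exact: fine_ge0.
have xaE : - (x + a) + a = - x by ring.
apply: (ge0_integral_ge_itv _ _ (- (x + a))) => //.
- apply: measurable_funTS; apply: measurable_funM; last first.
    exact: nondecreasing_measurable.
  exact: (measurableT_comp (measurable_powR beta) (@normr_measurable R setT)).
- by move=> y _; rewrite mulr_ge0 ?powR_ge0.
- by rewrite mulr_ge0 ?powR_ge0.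
- by move=> y /=; rewrite !in_itv /= xaE => /andP[].
- move=> y; rewrite xaE => /andP[xy yx]; rewrite ler_pM ?powR_ge0 // ?Gmono //.
  have xy' : x <= `|y| by rewrite ler0_norm; lra.
  by rewrite ge0_ler_powR // nnegrE ltW // (lt_le_trans x0).
Qed.

Lemma geometric_decay (G : R -> R) (x0 a q : R) : 0 <= q -> 0 <= a ->
  (forall x, x0 <= x -> G (x + a) <= q * G x) -> G x0 <= 1 ->
  forall k, G (x0 + k%:R * a) <= q ^+ k.
Proof.
move=> q0 a0 Gq G1; elim=> [|k ih]; first by rewrite mul0r addr0 expr0.
rewrite mulrSr mulrDl mul1r addrA exprS.
apply: le_trans (Gq _ _) _; first by rewrite lerDl mulr_ge0.
exact: ler_wpM2l.
Qed.

Lemma measurable_norm_ge d (T : measurableType d) (P : probability T R)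
    (X : {RV P >-> R}) (c : R) : measurable [set w | (c <= `|X w|)%R].
Proof.
have mX : measurable_fun [set: T] (fun w => `|X w|) by exact: measurableT_comp.
have := mX measurableT _ (measurable_itv `[c, +oo[); rewrite setTI.
rewrite (_ : _ @^-1` _ = [set w | (c <= `|X w|)%R]) //.
by apply/seteqP; split=> w /=; rewrite in_itv /= andbT.
Qed.

(** Beyond N a each step of length a multiplies a tail by at most q, since there s <= q a x^beta.
    The factor q^(-N) makes the bound trivial for k < N, and the 2 counts the two tails. *)
Lemma class_M_geometric_tail d (T : measurableType d) (P : probability T R)
    (X : {RV P >-> R}) beta m s (N : nat) a q :
  0 <= beta -> 0 < m -> class_M beta m s (distribution P X) ->
  0 < a -> 0 < q <= 1 -> m <= N%:R * a -> s <= q * (a * (N%:R * a) `^ beta) ->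
  forall k, (P [set w | (k%:R * a <= `|X w|)%R] <= (2 * q ^- N * q ^+ k)%:E)%E.
Proof.
move=> b0 m0 cM a0 /andP[q0 q1] mN sq k.
have Na0 : 0 < N%:R * a by apply: lt_le_trans mN.
have mA := measurable_norm_ge _ _ _ X (k%:R * a).
have [kN|Nk] := ltnP k N.
  apply: le_trans (probability_le1 _ mA) _; rewrite lee_fin.
  have : 1 <= q ^- N * q ^+ k.
    by rewrite ler_pdivlMl ?exprn_gt0 // mulr1 ler_wiXn2l // ?ltW // ltnW.
  by rewrite -mulrA; lra.
have decay (G : R -> R) : (forall x, 0 <= G x) ->
    (forall x, m <= x -> a * x `^ beta * G (x + a) <= s * G x) ->
    G (N%:R * a) <= 1 -> G (k%:R * a) <= q ^+ (k - N).
  move=> G0 Gs G1.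
  have := geometric_decay G (N%:R * a) a q (ltW q0) (ltW a0) _ G1 (k - N).
  rewrite -mulrDl -natrD subnKC //; apply=> x xN.
  have x0 : 0 < x by apply: lt_le_trans xN.
  have p0 : 0 < a * x `^ beta by rewrite mulr_gt0 // powR_gt0.
  rewrite -(ler_pM2l p0); apply: le_trans (Gs _ (le_trans mN xN)) _.
  rewrite mulrA [_ * q]mulrC ler_wpM2r //; apply: le_trans sq _.
  rewrite ler_wpM2l ?(ltW q0) // ler_wpM2l ?(ltW a0) //.
  by rewrite ge0_ler_powR // nnegrE ltW.
pose mu := distribution P X.
have hr : fine (mu `[k%:R * a, +oo[%classic) <= q ^+ (k - N).
  apply: (decay (fun x => fine (mu `[x, +oo[%classic))).
  - by move=> x; exact: fine_ge0.
  - by move=> x mx; exact: class_M_right b0 m0 cM mx a0.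
  - by rewrite -lee_fin fine_measureK // probability_le1.
have hl : fine (mu `]-oo, - (k%:R * a)]%classic) <= q ^+ (k - N).
  apply: (decay (fun x => fine (mu `]-oo, - x]%classic))).
  - by move=> x; exact: fine_ge0.
  - by move=> x mx; exact: class_M_left b0 m0 cM mx a0.
  - by rewrite -lee_fin fine_measureK // probability_le1.
rewrite (_ : mkset _ = X @^-1` `[k%:R * a, +oo[%classic `|`
    X @^-1` `]-oo, - (k%:R * a)]%classic); last first.
  apply/seteqP; split=> w /=; rewrite !in_itv /= andbT ler_normr.
    by case/orP => h; [left|right]; rewrite // lerNr.
  by case=> h; apply/orP; [left|right]; rewrite // lerNr.
apply: le_trans (measureU2 _ _ _) _.
- by rewrite -[_ @^-1` _]setTI; exact: measurable_funPT.
- by rewrite -[_ @^-1` _]setTI; exact: measurable_funPT.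
apply: (@le_trans _ _ ((fine (mu `[(k%:R * a)%R, +oo[%classic))%:E +
    (fine (mu `]-oo, (- (k%:R * a))%R]%classic))%:E)%E).
  by rewrite !fine_measureK.
rewrite -EFinD lee_fin.
have -> : 2 * q ^- N * q ^+ k = q ^+ (k - N) + q ^+ (k - N).
  rewrite -{1}(subnK Nk) exprD; field.
  by rewrite gt_eqF // exprn_gt0.
exact: lerD.
Qed.

End class_M_tails.

Section exponential_moments.
Context {d : measure_display} {T : measurableType d} {R : realType}.
Context {P : probability T R}.

Definition layer (a x : R) : nat := Num.trunc (`|x| / a).

(** Value at the right end of the layer k a <= |x| < (k + 1) a, hence [k.+1]. For l >= 0 this gives
    a majorant of exp(l |x|) with countably many values, the form required by
    [independent_product]. *)
Definition exp_layer (l a : R) (k : nat) : R := expR (l * a * k.+1%:R).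

Lemma measurable_layer a k : 0 < a -> measurable (layer a @^-1` [set k]).
Proof.
move=> a0.
have := @normr_measurable R setT measurableT _
  (measurable_itv `[k%:R * a, k.+1%:R * a[).
rewrite setTI; set A := _ @^-1` _; suff -> : layer a @^-1` [set k] = A by [].
apply/seteqP; split=> x; rewrite /A /= in_itv /= -ler_pdivlMr // -ltr_pdivrMr //.
  by move=> <-; apply: truncn_itv; rewrite divr_ge0 // ltW.
by rewrite /layer => h; apply: truncn_def.
Qed.

Lemma measurable_exp_layer l a : 0 < a ->
  measurable_fun [set: R] (exp_layer l a \o layer a).
Proof.
move=> a0; apply: (@measurableT_comp _ _ _ _ _ _ (exp_layer l a)) => //.
move=> _ B _; rewrite setTI.
rewrite (_ : _ @^-1` B = \bigcup_(k in B) (layer a @^-1` [set k])); last first.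
  by apply/seteqP; split=> [x Bx|x [k Bk /= h]]; [exists (layer a x)|rewrite /= h].
by apply: bigcup_measurable => k _; exact: measurable_layer.
Qed.

Lemma expR_le_layer l a x : 0 <= l -> 0 < a ->
  expR (l * `|x|) <= exp_layer l a (layer a x).
Proof.
move=> l0 a0; rewrite ler_expR -mulrA ler_wpM2l // mulrC -ler_pdivrMr //.
by rewrite ltW // truncnS_gt.
Qed.

(** Layer k has mass at most K q^k and value exp(l a)^(k + 1), so a geometric series of ratio exp(l
    a) q dominates. *)
Lemma exp_layer_integral (X : {RV P >-> R}) (l a q K : R) :
  0 < a -> 0 <= q -> expR (l * a) * q < 1 ->
  (forall k, (P [set w | (k%:R * a <= `|X w|)%R] <= (K * q ^+ k)%:E)%E) ->
  (\int[P]_w (exp_layer l a (layer a (X w)))%:E < +oo)%E.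
Proof.
move=> a0 q0 r1 tail.
pose F k := X @^-1` (layer a @^-1` [set k]).
have mF k : measurable (F k).
  by rewrite -[F k]setTI; apply: measurable_funPT => //; exact: measurable_layer.
have FT : \bigcup_k F k = [set: T].
  by apply/seteqP; split=> // w _; exists (layer a (X w)).
have tF : trivIset [set: nat] F by move=> k l' _ _ [w [/= <- <-]].
rewrite -FT ge0_integral_bigcup //; first last.
- by move=> w _; rewrite lee_fin expR_ge0.
- rewrite FT; apply/measurable_EFinP.
  exact: (measurableT_comp (measurable_exp_layer l a a0)).
pose r := expR (l * a) * q.
have r0 : 0 <= r by rewrite mulr_ge0 ?expR_ge0.
have step k : (\int[P]_(w in F k) (exp_layer l a (layer a (X w)))%:E <=
    (geometric (expR (l * a) * K) r k)%:E)%E.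
  rewrite (eq_integral (fun=> (exp_layer l a k)%:E)); last first.
    by move=> w; rewrite inE /F /= => ->.
  rewrite integral_cst //.
  apply: (@le_trans _ _ ((exp_layer l a k)%:E * (K * q ^+ k)%:E)%E).
    apply: lee_wpmul2l; first by rewrite lee_fin expR_ge0.
    apply: le_trans (tail k); apply: le_measure; rewrite ?inE //.
      exact: measurable_norm_ge.
    by move=> w <-; rewrite /= -ler_pdivlMr // truncn_le divr_ge0 // ltW.
  rewrite -EFinM lee_fin /exp_layer /geometric /= /r exprMn -expRM_natr.
  by rewrite mulrSr mulrDr mulr1 expRD; lra.
apply: (@le_lt_trans _ _ (\sum_(0 <= k <oo) (geometric (expR (l * a) * K) r k)%:E)%E).
  apply: lee_nneseries => [k _ _|k _] //.
  by apply: integral_ge0 => w _; rewrite lee_fin expR_ge0.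
have rn : `|r| < 1 by rewrite ger0_norm.
have cv := @cvg_geometric_series R (expR (l * a) * K) r rn.
rewrite (_ : (\sum_(0 <= k <oo) _)%E = (expR (l * a) * K / (1 - r))%:E) ?ltry //.
apply/cvg_lim => //.
rewrite (_ : (fun n => _) = EFin \o series (geometric (expR (l * a) * K) r)).
  by apply/fine_cvgP; split; [exact: nearW|exact: cv].
by apply/funext => k; rewrite /= sumEFin.
Qed.

Lemma integrable_expR_sum_norm (n : nat) (X : 'I_n -> {RV P >-> R})
    (beta m s l : R) (N : nat) (a q : R) :
  mutually_independent X -> 0 <= beta -> 0 < m ->
  (forall i, class_M beta m s (distribution P (X i))) ->
  0 < a -> 0 < q <= 1 -> m <= N%:R * a -> s <= q * (a * (N%:R * a) `^ beta) ->
  0 <= l -> expR (l * a) * q < 1 ->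
  P.-integrable [set: T] (EFin \o (fun w => expR (l * \sum_(i < n) `|X i w|))).
Proof.
move=> indX b0 m0 cM a0 q01 mN sq l0 r1.
have q0 : 0 <= q by case/andP: q01 => /ltW.
have fin := independent_product X (layer a) (exp_layer l a) indX
  (fun=> expR_ge0 _) (fun k => measurable_layer a k a0)
  (measurable_exp_layer l a a0)
  (fun i => exp_layer_integral (X i) l a q _ a0 q0 r1
    (class_M_geometric_tail _ _ _ _ _ _ _ _ _ _ b0 m0 (cM i) a0 q01 mN sq)).
have mexp : measurable_fun [set: T] (fun w => expR (l * \sum_(i < n) `|X i w|)).
  apply: measurableT_comp; first exact: measurable_expR.
  apply: measurable_funM; first exact: measurable_cst.
  by apply: measurable_sum => i; exact: measurableT_comp.
apply/integrableP; split; first exact/measurable_EFinP.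
apply: le_lt_trans fin; apply: ge0_le_integral => //.
- by apply/measurable_EFinP; apply: measurableT_comp.
- apply/measurable_EFinP; apply: measurable_prod => i _.
  exact: (measurableT_comp (measurable_exp_layer l a a0)).
- move=> w _; rewrite /= lee_fin ger0_norm ?expR_ge0 // mulr_sumr expR_sum.
  apply: ler_prod => i _; rewrite expR_ge0 /=.
  exact: expR_le_layer.
Qed.

End exponential_moments.

(** * Herbst's argument *)

Section herbst.
Context {d : measure_display} {T : measurableType d} {R : realType}.
Variables (P : probability T R) (psi : T -> R) (lam B : R).
Hypothesis mpsi : measurable_fun [set: T] psi.
Hypothesis lam_gt0 : 0 < lam.
Hypothesis B_ge0 : 0 <= B.
Hypothesis exp_int :
  P.-integrable [set: T] (EFin \o (fun w => expR (2 * lam * `|psi w|))).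

Let E (f : T -> R) : R := \int[P]_w f w.

(** The rate is 2 lam because one factor exp(lam |psi|) bounds the exponential in the integrand and
    the other absorbs a factor psi or psi^2. *)
Lemma exp_dominated (f : T -> R) (c : R) : measurable_fun [set: T] f ->
  0 <= c -> (forall w, `|f w| <= c * expR (2 * lam * `|psi w|)) ->
  P.-integrable [set: T] (EFin \o f).
Proof.
move=> mf c0 fle.
apply: (le_integrable measurableT _ _ (integrableZl measurableT c exp_int)).
  exact/measurable_EFinP.
move=> w _ /=; rewrite lee_fin; apply: le_trans (fle w) _.
exact: ler_norm.
Qed.

Lemma measurable_expRZ s : measurable_fun [set: T] (fun w => expR (s * psi w)).
Proof.
apply: measurableT_comp; first exact: measurable_expR.
by apply: measurable_funM => //; exact: measurable_cst.
Qed.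

Lemma integrable_psi : P.-integrable [set: T] (EFin \o psi).
Proof.
apply: (exp_dominated psi (2 * lam)^-1) => //.
  by rewrite invr_ge0 mulr_ge0 // ltW.
move=> w; rewrite ler_pdivlMl ?mulr_gt0 //.
by have := expR_ge1Dx (2 * lam * `|psi w|); lra.
Qed.

Lemma norm_sM s w : 0 <= s <= lam -> `|s * psi w| <= lam * `|psi w|.
Proof.
by move=> /andP[s0 sl]; rewrite normrM ger0_norm // ler_wpM2r.
Qed.

Lemma integrable_expRZ s : 0 <= s <= lam ->
  P.-integrable [set: T] (EFin \o (fun w => expR (s * psi w))).
Proof.
move=> sl; apply: (exp_dominated _ 1) => //; first exact: measurable_expRZ.
move=> w; rewrite ger0_norm ?expR_ge0 // mul1r ler_expR.
have := norm_sM s w sl; have := ler_norm (s * psi w).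
by have := mulr_ge0 (ltW lam_gt0) (normr_ge0 (psi w)); lra.
Qed.

Lemma integrable_MexpRZ s : 0 <= s <= lam ->
  P.-integrable [set: T] (EFin \o (fun w => s * psi w * expR (s * psi w))).
Proof.
move=> sl; apply: (exp_dominated _ 1) => //.
  apply: measurable_funM; last exact: measurable_expRZ.
  by apply: measurable_funM => //; exact: measurable_cst.
move=> w; rewrite normrM [X in _ * X]ger0_norm ?expR_ge0 // mul1r.
have h := norm_sM s w sl.
rewrite (_ : 2 * lam * _ = lam * `|psi w| + lam * `|psi w|); last by ring.
rewrite expRD; apply: ler_pM; rewrite ?expR_ge0 //.
  by apply: le_trans h _; have := expR_ge1Dx (lam * `|psi w|); lra.
by rewrite ler_expR (le_trans (ler_norm _)).
Qed.

Lemma integrable_sqrM :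
  P.-integrable [set: T] (EFin \o (fun w => psi w ^+ 2 * expR (lam * `|psi w|))).
Proof.
apply: (exp_dominated _ (2 / lam ^+ 2)) => //.
  apply: measurable_funM; first exact: measurable_funX.
  apply: measurableT_comp; first exact: measurable_expR.
  apply: measurable_funM; first exact: measurable_cst.
  exact: measurableT_comp.
  by rewrite divr_ge0 // sqr_ge0.
move=> w; rewrite ger0_norm; last first.
  by apply: mulr_ge0; [exact: sqr_ge0|exact: expR_ge0].
rewrite (_ : 2 * lam * _ = lam * `|psi w| + lam * `|psi w|); last by ring.
rewrite expRD mulrA ler_wpM2r ?expR_ge0 //.
(* The second-order term u^2 / 2 <= e^u at u = lam |psi w| is the origin of the constant
   [2 / lam ^+ 2]. *)
have := @expR_ge1Dxn R (lam * `|psi w|) 1.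
rewrite mulr_ge0 ?(ltW lam_gt0) // => /(_ isT).
rewrite exprMn real_normK ?num_real // (_ : 2`!%:R = 2) // => h.
rewrite mulrAC ler_pdivlMr ?exprn_gt0 //; lra.
Qed.

Hypothesis psi_centered : E psi = 0.

Let F s := E (fun w => expR (s * psi w)).

Hypothesis entropy_le : forall s, 0 < s <= lam ->
  E (fun w => s * psi w * expR (s * psi w)) <=
  F s * ln (F s) + B * s ^+ 2 * F s.

Lemma expR_le_quadratic (u : R) : expR u <= 1 + u + u ^+ 2 * expR `|u|.
Proof.
have h (v : R) : expR v - 1 <= v * expR v.
  have := ler_wpM2r (expR_ge0 v) (expR_ge1Dx (- v)).
  by rewrite -expRD addNr expR0; lra.
have h1 := h u; have h2 := expR_ge1Dx u.
have [u0|u0] := leP 0 u.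
  rewrite ger0_norm // expr2 -mulrA.
  by have := ler_wpM2l u0 h1; lra.
have : 1 <= expR `|u| by rewrite -expR0 ler_expR.
move=> /(ler_wpM2l (sqr_ge0 u)).
have : (- u) * (u) <= (- u) * (expR u - 1) by rewrite ler_wpM2l //; lra.
by rewrite expr2; lra.
Qed.

Lemma integrable_1D s :
  P.-integrable [set: T] (EFin \o (fun w => 1 + s * psi w)).
Proof.
have i1 : P.-integrable [set: T] (EFin \o (cst 1)).
  exact: finite_measure_integrable_cst.
exact: (integrableD measurableT i1 (integrableZl measurableT s integrable_psi)).
Qed.

Lemma mean_1D s : E (fun w => 1 + s * psi w) = 1.
Proof.
have i1 : P.-integrable [set: T] (EFin \o (cst 1)).
  exact: finite_measure_integrable_cst.
rewrite /E RintegralD //; last exact: (integrableZl measurableT s integrable_psi).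
rewrite RintegralZl //; last exact: integrable_psi.
rewrite [X in _ + s * X]psi_centered mulr0 addr0 Rintegral_cst //.
by rewrite mul1r [X in fine X]probability_setT.
Qed.

Lemma mgf_gt0 s : 0 <= s <= lam -> 0 < F s.
Proof.
move=> sl; apply: (@lt_le_trans _ _ 1) => //.
rewrite -(mean_1D s); apply: le_Rintegral => //.
- exact: integrable_1D.
- exact: integrable_expRZ.
- by move=> w _; exact: expR_ge1Dx.
Qed.

(** Centering removes the first-order term. The constant is crude and serves only to make ln (F s) /
    s^2 bounded, so that its supremum is a real number. *)
Lemma ln_mgf_quadratic s : 0 < s <= lam ->
  ln (F s) <= s ^+ 2 * E (fun w => psi w ^+ 2 * expR (lam * `|psi w|)).
Proof.
move=> /andP[s0 sl]; have sl' : 0 <= s <= lam by rewrite ltW.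
apply: (@le_trans _ _ (F s - 1)).
  have h : -1 < F s - 1 by have := mgf_gt0 s sl'; lra.
  by have := le_ln1Dx h; rewrite addrC subrK.
rewrite lerBlDl.
have i1 := integrable_1D s.
have i2 : P.-integrable [set: T] (EFin \o
    (fun w => s ^+ 2 * (psi w ^+ 2 * expR (lam * `|psi w|)))).
  exact: (integrableZl measurableT (s ^+ 2) integrable_sqrM).
apply: (@le_trans _ _ (E (fun w => (1 + s * psi w) +
    s ^+ 2 * (psi w ^+ 2 * expR (lam * `|psi w|))))).
  apply: le_Rintegral => //; [exact: integrable_expRZ| |].
    exact: (integrableD measurableT i1 i2).
  move=> w _; apply: le_trans (expR_le_quadratic _) _.
  rewrite lerD2l exprMn -mulrA ler_wpM2l ?sqr_ge0 // ler_wpM2l ?sqr_ge0 //.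
  by rewrite ler_expR norm_sM.
rewrite /E RintegralD // RintegralZl //; last exact: integrable_sqrM.
by rewrite lerD2r -/(E _) mean_1D.
Qed.

(* e^u >= e^(-a) (1 + u + a) with u = (theta - 1) s psi and the right a. *)
Lemma ln_mgf_shrink s theta : 0 < s <= lam -> 0 < theta < 1 ->
  theta * ln (F s) - (1 - theta) * (B * s ^+ 2) <= ln (F (theta * s)).
Proof.
move=> /andP[s0 sl] /andP[t0 t1]; have sl' : 0 <= s <= lam by rewrite ltW.
have tsl : 0 <= theta * s <= lam.
  have ts : theta * s <= lam by apply: (le_trans _ sl); rewrite ger_pMl // ltW.
  by rewrite ts mulr_ge0 // ltW.
(* [entropy_le] bounds the tilted mean of s psi by ln (F s) + B s^2; with this [a] the tilted mean
   of (theta - 1) s psi + a is nonnegative. *)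
pose a := (1 - theta) * (ln (F s) + B * s ^+ 2).
have Fs := mgf_gt0 s sl'; have Fts := mgf_gt0 _ tsl.
have aF : expR (- a) * F s <= F (theta * s).
  have ie := integrable_expRZ s sl'; have iM := integrable_MexpRZ s sl'.
  have i1 : P.-integrable [set: T]
      (EFin \o (fun w => (1 + a) * expR (s * psi w))).
    exact: (integrableZl measurableT (1 + a) ie).
  have i2 : P.-integrable [set: T]
      (EFin \o (fun w => (1 - theta) * (s * psi w * expR (s * psi w)))).
    exact: (integrableZl measurableT (1 - theta) iM).
  apply: (@le_trans _ _ (E (fun w => expR (- a) *
      ((1 + a) * expR (s * psi w) -
       (1 - theta) * (s * psi w * expR (s * psi w)))))).
    rewrite /E RintegralZl //; last exact: (integrableB measurableT i1 i2).
    rewrite ler_wpM2l ?expR_ge0 // RintegralB // !RintegralZl //.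
    have h : (1 - theta) * E (fun w => s * psi w * expR (s * psi w)) <=
        (1 - theta) * (F s * ln (F s) + B * s ^+ 2 * F s).
      by rewrite ler_wpM2l ?entropy_le ?s0 //; lra.
    change (F s <= (1 + a) * F s -
      (1 - theta) * E (fun w => s * psi w * expR (s * psi w))).
    by move: h; rewrite /a; lra.
  apply: le_Rintegral => //.
  - apply: (integrableZl measurableT (expR (- a)) (integrableB _ i1 i2)) => //.
  - exact: integrable_expRZ.
  move=> w _.
  rewrite (_ : theta * s * psi w = s * psi w - a +
    ((theta - 1) * (s * psi w) + a)); last by ring.
  rewrite expRD.
  apply: (@le_trans _ _ (expR (s * psi w - a) *
    (1 + ((theta - 1) * (s * psi w) + a)))).
    by rewrite expRD; lra.
  by rewrite ler_wpM2l ?expR_ge0 // expR_ge1Dx.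
have : ln (expR (- a) * F s) <= ln (F (theta * s)).
  by rewrite ler_ln // posrE // mulr_gt0 ?expR_gt0.
by rewrite lnM ?posrE ?expR_gt0 // expRK /a; lra.
Qed.

Lemma herbst : E (fun w => expR (lam * psi w)) <= expR (B * lam ^+ 2).
Proof.
pose f s := ln (F s) / s ^+ 2.
pose S := [set f s | s in [set s | 0 < s <= lam]].
have Sub : has_ubound S.
  exists (E (fun w => psi w ^+ 2 * expR (lam * `|psi w|))) => _ [s /= sl <-].
  rewrite /f ler_pdivrMr ?exprn_gt0 ?(andP sl).1 // mulrC.
  exact: ln_mgf_quadratic.
have lamS : 0 < lam <= lam by rewrite lam_gt0 lexx.
have S0 : S !=set0 by exists (f lam), lam.
have fS s : 0 < s <= lam -> f s <= sup S by move=> sl; apply: ub_le_sup => //; exists s.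
have step theta : 0 < theta < 1 -> theta * sup S <= B.
  move=> /andP[t0 t1].
  (* [ln_mgf_shrink] is combined with [f (theta * s) <= sup S] and divided by theta s^2: two powers
     of theta against one leave the contraction factor theta. *)
  have : sup S <= theta * sup S + (1 - theta) / theta * B.
    apply: ge_sup => // _ [s /= sl <-].
    have s0 := (andP sl).1; have sl1 := (andP sl).2.
    have tsl : 0 < theta * s <= lam.
      rewrite mulr_gt0 //=; apply: (le_trans _ sl1).
      by rewrite ger_pMl // ltW.
    have := ln_mgf_shrink s theta sl; rewrite t0 t1 => /(_ isT).
    have := fS _ tsl; rewrite {1}/f ler_pdivrMr ?exprn_gt0 ?mulr_gt0 // => h1 h2.
    rewrite /f ler_pdivrMr ?exprn_gt0 // -(ler_pM2l t0).
    have e1 : theta * ((theta * sup S + (1 - theta) / theta * B) * s ^+ 2) =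
      sup S * (theta * s) ^+ 2 + (1 - theta) * (B * s ^+ 2).
      by field; rewrite gt_eqF.
    rewrite e1; lra.
  have t1' : 0 < 1 - theta by lra.
  move=> h; rewrite -(ler_pM2l t1').
  have e2 : theta * ((1 - theta) / theta * B) = (1 - theta) * B.
    by field; rewrite gt_eqF.
  by have := ler_wpM2l (ltW t0) h; rewrite mulrDr e2; lra.
have SB : sup S <= B.
  rewrite leNgt; apply/negP => BS.
  have S0' : 0 < sup S by apply: le_lt_trans BS.
  (* For this theta, theta sup S is the midpoint of B and sup S, which exceeds B. *)
  have th : 0 < (B + sup S) / (2 * sup S) < 1.
    apply/andP; split; first by rewrite divr_gt0 ?mulr_gt0 // ltr_wpDl.
    by rewrite ltr_pdivrMr ?mulr_gt0 // mul1r mulr_natl mulr2n ltrD2r.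
  have := step _ th.
  rewrite [X in X <= _](_ : _ = (B + sup S) / 2); last by field; rewrite gt_eqF.
  lra.
have := le_trans (fS _ lamS) SB.
rewrite /f ler_pdivrMr ?exprn_gt0 // => h.
rewrite -/(F lam) -[leLHS]lnK ?posrE ?ler_expR //.
by apply: mgf_gt0; rewrite lexx ltW.
Qed.

End herbst.

(** * Lipschitz bounds and smooth approximation *)

Section lpnorm_duality.
Context {R : realType} {n : nat}.
Implicit Types x y v g : 'rV[R]_n.

Lemma lpnorm_ge0 p x : 0 <= lpnorm p x.
Proof. exact: powR_ge0. Qed.

Lemma lpnorm1 x : lpnorm 1 x = \sum_(i < n) `|x 0 i|.
Proof.
rewrite /lpnorm invr1; under eq_bigr do rewrite powRr1 //.
by rewrite powRr1 // sumr_ge0.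
Qed.

Lemma sqr_lpnorm2 x : lpnorm 2 x ^+ 2 = \sum_(i < n) x 0 i ^+ 2.
Proof.
rewrite /lpnorm; under eq_bigr do rewrite (powR_mulrn 2) // real_normK ?num_real //.
have s0 : 0 <= \sum_(i < n) x 0 i ^+ 2 by apply: sumr_ge0 => i _; exact: sqr_ge0.
by rewrite powR12_sqrt // sqr_sqrtr.
Qed.

Lemma sum_sqr_le (I : Type) (s : seq I) (f : I -> R) : (forall i, 0 <= f i) ->
  \sum_(i <- s) f i ^+ 2 <= (\sum_(i <- s) f i) ^+ 2.
Proof.
move=> f0; elim: s => [|i s ih]; first by rewrite !big_nil expr0n.
rewrite !big_cons sqrrD -addrA lerD2l; apply: le_trans ih _.
by rewrite lerDr mulrn_wge0 // mulr_ge0 // sumr_ge0.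
Qed.

Lemma lpnorm2_le_sum x : lpnorm 2 x <= \sum_(i < n) `|x 0 i|.
Proof.
have s0 : 0 <= \sum_(i < n) `|x 0 i| by exact: sumr_ge0.
rewrite -(ler_pXn2r (ltn0Sn 1)) ?nnegrE ?lpnorm_ge0 // sqr_lpnorm2.
rewrite (eq_bigr (fun i => `|x 0 i| ^+ 2)) => [|i _]; first exact: sum_sqr_le.
by rewrite real_normK ?num_real.
Qed.

Lemma lpnorm2_le_lpnorm1 x : lpnorm 2 x <= lpnorm 1 x.
Proof. by rewrite [leRHS]lpnorm1; exact: lpnorm2_le_sum. Qed.

Lemma dual_lpnorm2 g (L : R) : (forall v, dot g v <= L * lpnorm 2 v) ->
  lpnorm 2 g ^+ 2 <= L ^+ 2.
Proof.
move=> /(_ g); rewrite (_ : dot g g = lpnorm 2 g ^+ 2); last first.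
  by rewrite sqr_lpnorm2 /dot; apply: eq_bigr => i _; rewrite expr2.
have := lpnorm_ge0 2 g; rewrite le_eqVlt => /predU1P[<- _|N0].
  by rewrite expr0n sqr_ge0.
rewrite expr2 ler_pM2r // => NL.
by rewrite !expr2 ler_pM // ltW.
Qed.

Lemma dual_lpnorm1 g (L : R) : (forall v, dot g v <= L * lpnorm 1 v) ->
  forall i, `|g 0 i| <= L.
Proof.
move=> h i; rewrite ler_norml lerNl -{1}mulN1r -!dot_delta -dotZr.
have N1 (c : R) : lpnorm 1 (c *: delta_mx 0 i : 'rV[R]_n) = `|c|.
  rewrite lpnorm1 (bigD1 i) //= !mxE !eqxx mulr1 big1 ?addr0 // => j ji.
  by rewrite !mxE eqxx (negbTE ji) mulr0 normr0.
have := h (-1 *: delta_mx 0 i); have := h (1 *: delta_mx 0 i).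
by rewrite !N1 normrN normr1 mulr1 scale1r => -> ->.
Qed.

(* Test vector for the duality: v_i = sgn(g_i) |g_i|^(q-1). *)
Lemma dual_lpnorm g (beta L : R) (q := (beta + 1) / beta) : 0 < beta -> 0 <= L ->
  (forall v, dot g v <= L * lpnorm (1 + beta) v) -> lpnorm q g `^ q <= L `^ q.
Proof.
move=> b0 L0 h; have b1 : 0 < 1 + beta by lra.
have q0 : 0 < q by rewrite /q divr_gt0 //; lra.
pose S := \sum_(i < n) `|g 0 i| `^ q.
have S0 : 0 <= S by apply: sumr_ge0 => i _; exact: powR_ge0.
rewrite /lpnorm -/S -powRrM mulVf ?gt_eqF // powRr1 //.
pose v : 'rV[R]_n := \row_i (Num.sg (g 0 i) * `|g 0 i| `^ (q - 1)).
move: (h v); rewrite (_ : dot g v = S); last first.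
  apply: eq_bigr => i _; rewrite mxE mulrA [_ * Num.sg _]mulrC -normrEsg.
  by rewrite mulr_powRB1.
rewrite (_ : lpnorm _ v = S `^ (1 + beta)^-1); last first.
  rewrite /lpnorm; congr (_ `^ _); apply: eq_bigr => i _; rewrite mxE.
  have [->|gi0] := eqVneq (g 0 i) 0.
    by rewrite sgr0 mul0r normr0 !powR0 // gt_eqF.
  rewrite normrM normr_sg gi0 mul1r ger0_norm ?powR_ge0 // -powRrM.
  by congr (_ `^ _); rewrite /q; field; rewrite gt_eqF.
move: S0; rewrite le_eqVlt => /predU1P[<- _|S0]; first exact: powR_ge0.
(* q and 1 + beta are conjugate exponents; cancelling the second factor leaves the bound L for
   S^(1/q). *)
have S1 : S = S `^ q^-1 * S `^ (1 + beta)^-1.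
  rewrite -powRD ?(gt_eqF S0) ?implybT // (_ : q^-1 + (1 + beta)^-1 = 1).
    by rewrite powRr1 // ltW.
  by rewrite /q; field; rewrite !gt_eqF //=; lra.
rewrite {1}S1 ler_pM2r ?powR_gt0 // => SL.
rewrite -[S](powRr1 (ltW S0)) -(mulVf (lt0r_neq0 q0)) powRrM.
by rewrite ge0_ler_powR ?nnegrE ?powR_ge0 // ltW.
Qed.

End lpnorm_duality.

Section smooth_approximation.
Context {R : realType} {n : nat}.
Implicit Types x y v : 'rV[R]_n.

Lemma dotZl (k : R) a v : dot (k *: a : 'rV[R]_n) v = k * dot a v.
Proof. by rewrite /dot mulr_sumr; apply: eq_bigr => i _; rewrite mxE mulrA. Qed.

Lemma rat_row_approx x (eps : R) : 0 < eps ->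
  exists r : 'rV[rat]_n, \sum_(i < n) `|x 0 i - ratr (r 0 i)| <= eps.
Proof.
move=> e0; have d0 : 0 < eps / n.+1%:R by rewrite divr_gt0.
have /choice[r rP] (i : 'I_n) :
    exists r : rat, `|x 0 i - ratr r| <= eps / n.+1%:R.
  have /rat_in_itvoo[r] : x 0 i < x 0 i + eps / n.+1%:R by rewrite ltrDl.
  rewrite in_itv /= => /andP[xr rx]; exists r.
  by rewrite distrC gtr0_norm ?subr_gt0 // lerBlDl ltW.
exists (\row_i r i).
apply: (@le_trans _ _ (\sum_(i < n) eps / n.+1%:R)).
  by apply: ler_sum => i _; rewrite mxE.
rewrite sumr_const card_ord -[X in X *+ _]mulr1 -mulrnAr -mulrA.
rewrite ler_piMr ?(ltW e0) // mulrC ler_pdivrMr // mul1r ler_nat //.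
Qed.

(** The second clause controls a slope by increments of [phi] from one point, so that it inherits
    every Lipschitz bound of [phi], whatever the norm. *)
Lemma affine_minorants (phi : 'rV[R]_n -> R) (K : R) : convex_on_Rn phi ->
  0 <= K -> (forall x y, `|phi x - phi y| <= K * \sum_(i < n) `|x 0 i - y 0 i|) ->
  exists (a : nat -> 'rV[R]_n) (b : nat -> R), [/\
    forall j x, dot (a j) x + b j <= phi x,
    forall j, exists z, forall v, dot (a j) v <= phi (z + v) - phi z &
    forall x eps, 0 < eps -> exists j, phi x - eps <= dot (a j) x + b j].
Proof.
move=> cphi K0 phiK.
have /choice[grd grdP] z := convex_subgradient phi z cphi.
pose z (j : nat) : 'rV[R]_n :=
  map_mx ratr (odflt (0 : 'rV[rat]_n) (unpickle j)).
exists (grd \o z), (fun j => phi (z j) - dot (grd (z j)) (z j)); split=> /=.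
- by move=> j x; have := grdP (z j) x; rewrite dotBr; lra.
- by move=> j; exists (z j) => v; have := grdP (z j) (z j + v);
    rewrite addrAC subrr add0r; lra.
move=> x eps e0.
have e0' : 0 < eps / (2 * K + 1) by rewrite divr_gt0 //; lra.
have [r rP] := rat_row_approx x _ e0'.
exists (pickle r).
have zE : z (pickle r) = map_mx ratr r by rewrite /z pickleK.
rewrite zE; set y := map_mx _ r.
(* Testing the subgradient at y in the reflected point 2 y - x bounds it from below in the direction
   x - y. The tangent at y thus misses phi x by at most 2 K times the distance, whence [2 * K + 1];
   the 1 covers K = 0. *)
have h1 := phiK x y; have h2 := phiK (y + (y - x)) y.
have dE : \sum_(i < n) `|(y + (y - x)) 0 i - y 0 i| = \sum_(i < n) `|x 0 i - y 0 i|.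
  by apply: eq_bigr => i _; rewrite !mxE distrC; congr `| _ |; ring.
rewrite dE in h2.
have dy : \sum_(i < n) `|x 0 i - y 0 i| <= eps / (2 * K + 1).
  by apply: le_trans rP; apply: ler_sum => i _; rewrite mxE.
have dK : 2 * (K * \sum_(i < n) `|x 0 i - y 0 i|) <= eps.
  apply: (@le_trans _ _ (2 * K * (eps / (2 * K + 1)))).
    by rewrite mulrA ler_wpM2l // mulr_ge0.
  rewrite mulrCA ler_piMr ?(ltW e0) // ler_pdivrMr; lra.
have := grdP y (y + (y - x)); rewrite [_ + _ - y]addrAC subrr add0r dotBr.
move: h1 h2; rewrite !ler_norml => /andP[_ h1] /andP[_ h2]; lra.
Qed.

Variables (a : nat -> 'rV[R]_n) (b : nat -> R).

(* Chosen so that temperature k * ln (k + 1) <= 1 / (k + 1). *)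
Definition temperature (k : nat) : R := (k.+1%:R * (1 + ln k.+1%:R))^-1.

(** Subtracting [e * ln k.+1%:R] puts the soft maximum of the first k + 1 minorants below their
    maximum. The factor [s] and the centering [c] are built in, so that the rescaled function is
    still an [lse], smooth and convex. *)
Definition soft_max (k : nat) (s c : R) : 'rV[R]_n -> R :=
  let e := temperature k in
  @lse R n k (fun j => e^-1 *: a j) (fun j => e^-1 * b j)
    (s * e) (- (s * (e * ln k.+1%:R + c))).

Lemma ln_nat_ge0 k : 0 <= ln (k.+1%:R : R).
Proof. by apply: ln_ge0; rewrite ler1n. Qed.

Lemma temperature_gt0 k : 0 < temperature k.
Proof. by rewrite invr_gt0 mulr_gt0 //; have := ln_nat_ge0 k; lra. Qed.

Lemma soft_maxE k s c x : soft_max k s c x = s * (soft_max k 1 0 x - c).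
Proof. by rewrite /soft_max /lse; ring. Qed.

Lemma smooth_soft_max k s c : smooth (soft_max k s c).
Proof. exact: smooth_lse. Qed.

Lemma convex_soft_max k s c : 0 <= s -> convex_on_Rn (soft_max k s c).
Proof.
by move=> s0; apply: convex_lse; rewrite mulr_ge0 // ltW // temperature_gt0.
Qed.

Lemma dot_grad_soft_max k s c x v (M : R) : 0 <= s ->
  (forall j, dot (a j) v <= M) -> dot (grad (soft_max k s c) x) v <= s * M.
Proof.
move=> s0 aM; rewrite grad_lse dot_lse_grad -mulrA ler_wpM2l // mulr_sumr.
rewrite -[leRHS]mul1r -(@sum_weight R n k
  (fun j => (temperature k)^-1 *: a j) (fun j => (temperature k)^-1 * b j) x).
rewrite mulr_suml; apply: ler_sum => j _.
set w := weight _ _ _ _; have w0 : 0 <= w by exact: weight_ge0.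
rewrite dotZl (_ : _ * _ = w * dot (a j) v); first exact: ler_wpM2l.
by field; rewrite gt_eqF // temperature_gt0.
Qed.

Lemma soft_max_le k x (M : R) : (forall j, dot (a j) x + b j <= M) ->
  soft_max k 1 0 x <= M.
Proof.
move=> aM; have e0 := temperature_gt0 k.
rewrite /soft_max /lse mul1r addr0 mul1r -mulrBr -ler_pdivlMl //.
rewrite lerBlDr -[X in X + _]expRK -lnM ?posrE ?expR_gt0 //.
rewrite ler_ln ?posrE ?mulr_gt0 ?expR_gt0 ?expsum_gt0 //.
apply: (@le_trans _ _ (\sum_(j < k.+1) expR ((temperature k)^-1 * M))).
  apply: ler_sum => j _; rewrite ler_expR dotZl -mulrDr ler_wpM2l //.
  by rewrite invr_ge0 ltW.
by rewrite sumr_const card_ord mulr_natr.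
Qed.

Lemma soft_max_ge k j x : (j <= k)%N ->
  dot (a j) x + b j - k.+1%:R^-1 <= soft_max k 1 0 x.
Proof.
move=> jk; have e0 := temperature_gt0 k.
rewrite /soft_max /lse mul1r addr0 mul1r; apply: lerD; last first.
  rewrite lerN2 /temperature invfM -mulrA ler_piMr // mulrC.
  by rewrite ler_pdivrMr; have := ln_nat_ge0 k; lra.
rewrite -ler_pdivrMl // -[leLHS]expRK ler_ln ?posrE ?expR_gt0 ?expsum_gt0 //.
rewrite /expsum (bigD1 (Ordinal (jk : (j < k.+1)%N))) //= dotZl -mulrDr.
by rewrite lerDl sumr_ge0 // => i _; exact: expR_ge0.
Qed.

End smooth_approximation.

Lemma norm_sub_le (R : realDomainType) (u u0 p q r : R) :
  u - p <= u0 -> u0 + q <= u -> p <= r -> - q <= r -> `|u - u0| <= r.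
Proof. by rewrite ler_norml => h1 h2 h3 h4; apply/andP; split; lra. Qed.

(** * From the entropy inequality to an exponential bound for a Lipschitz convex function *)

Section entropy_real.
Context {d : measure_display} {T : measurableType d} {R : realType}.
Variable P : probability T R.

(** The integral of a nonnegative function is a supremum over simple functions below it, hence
    monotone without measurability. This is what allows the gradient term to be replaced by its
    pointwise bound. *)
Lemma ge0_le_integral_nonmeasurable (f g : T -> \bar R) :
  (forall w, 0 <= f w)%E -> (forall w, f w <= g w)%E ->
  (\int[P]_w f w <= \int[P]_w g w)%E.
Proof.
move=> f0 fg; have g0 w : (0 <= g w)%E by exact: le_trans (fg w).
rewrite !ge0_integralTE //; apply: ge_ereal_sup => _ [h /= hf <-].
by apply: ereal_sup_ubound; exists h => // w; exact: le_trans (fg w).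
Qed.

Lemma EFin_Rintegral (f : T -> R) : P.-integrable [set: T] (EFin \o f) ->
  (\int[P]_w (f w)%:E = (\int[P]_w f w)%:E)%E.
Proof. by move=> fi; rewrite /Rintegral fineK //; exact: integrable_fin_num fi. Qed.

Lemma Ent_expR_le (psi G : T -> R) (C D : R) :
  P.-integrable [set: T] (EFin \o (fun w => expR (psi w))) ->
  P.-integrable [set: T] (EFin \o (fun w => psi w * expR (psi w))) ->
  0 <= C -> 0 < \int[P]_w expR (psi w) -> (forall w, 0 <= G w <= D) ->
  (Ent P (fun w => expR (psi w)) <=
   C%:E * 'E_P[fun w => (G w * expR (psi w))%R])%E ->
  \int[P]_w (psi w * expR (psi w)) <=
  (\int[P]_w expR (psi w)) * ln (\int[P]_w expR (psi w)) +
  C * D * \int[P]_w expR (psi w).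
Proof.
move=> ie iM C0 F0 GD; rewrite /Ent.
have -> : (fun w => expR (psi w) * ln (expR (psi w))) =
    (fun w => psi w * expR (psi w)).
  by apply/funext => w; rewrite expRK mulrC.
pose M := \int[P]_w (psi w * expR (psi w)); pose F := \int[P]_w expR (psi w).
have eM : ('E_P[fun w => (psi w * expR (psi w))%R] = M%:E)%E.
  by rewrite expectation.unlock EFin_Rintegral.
have eE : ('E_P[fun w => expR (psi w)] = F%:E)%E.
  by rewrite expectation.unlock EFin_Rintegral.
rewrite eM eE ltry lne_EFin // expectation.unlock => h.
rewrite -lerBlDl -lee_fin; apply: le_trans h _.
rewrite -mulrA EFinM; apply: lee_wpmul2l; first by rewrite lee_fin.
have iD : P.-integrable [set: T] (EFin \o (fun w => D * expR (psi w))).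
  exact: (integrableZl measurableT D ie).
apply: (@le_trans _ _ (\int[P]_w (D * expR (psi w))%:E)%E).
  apply: ge0_le_integral_nonmeasurable => w; rewrite lee_fin;
    have /andP[G0 GDw] := GD w; first by rewrite mulr_ge0 ?expR_ge0.
  by rewrite ler_wpM2r ?expR_ge0.
by rewrite (EFin_Rintegral (fun w => D * expR (psi w))) // RintegralZl.
Qed.

End entropy_real.

Section exponential_concentration.
Context {d : measure_display} {T : measurableType d} {R : realType}.
Context {P : probability T R} {n : nat}.
Variable X : 'I_n -> {RV P >-> R}.

Let Z := random_vector X.

Lemma measurable_dot (a : 'rV[R]_n) : measurable_fun [set: T] (fun w => dot a (Z w)).
Proof.
apply: measurable_sum => i; apply: measurable_funM; first exact: measurable_cst.
rewrite (_ : (fun w => _) = X i); first exact: measurable_funPT.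
by apply/funext => w; rewrite mxE.
Qed.

Lemma measurable_lse N (a : 'I_N.+1 -> 'rV[R]_n) b k c :
  measurable_fun [set: T] (fun w => lse a b k c (Z w)).
Proof.
apply: measurable_funD; last exact: measurable_cst.
apply: measurable_funM; first exact: measurable_cst.
apply: (@measurableT_comp _ _ _ _ _ _ (@ln R)); first exact: measurable_ln.
apply: measurable_sum => j.
apply: (@measurableT_comp _ _ _ _ _ _ (@expR R)); first exact: measurable_expR.
apply: measurable_funD; [exact: measurable_dot|exact: measurable_cst].
Qed.

Lemma chernoff_bound (Y : T -> R) (lam r M : R) :
  measurable_fun [set: T] Y -> 0 <= lam ->
  (\int[P]_w (expR (lam * Y w))%:E <= (expR M)%:E)%E ->
  (P [set w | (r <= Y w)%R] <= (expR (M - lam * r))%:E)%E.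
Proof.
move=> mY l0 h; set A := mkset _.
have mA : measurable A.
  rewrite (_ : A = Y @^-1` `[r, +oo[%classic).
    by rewrite -[_ @^-1` _]setTI; apply: mY => //; exact: measurable_itv.
  by apply/seteqP; split=> w; rewrite /A /= in_itv /= andbT.
have : ((expR (lam * r))%:E * P A <= (expR M)%:E)%E.
  apply: le_trans h.
  rewrite -[A]setIT -integral_indic // -ge0_integralZl_EFin ?expR_ge0 //.
    apply: ge0_le_integral_nonmeasurable => w; rewrite -EFinM lee_fin.
      by rewrite mulr_ge0 ?expR_ge0.
    rewrite indicE; case: (boolP (w \in A)) => [|_].
      by rewrite inE /A /= => rY; rewrite mulr1 ler_expR ler_wpM2l.
    by rewrite mulr0 expR_ge0.
  by apply/measurable_EFinP; exact: measurable_indic.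
have PA : P A \is a fin_num by rewrite fin_num_measure.
rewrite -(fineK PA) -EFinM !lee_fin expRB ler_pdivlMr ?expR_gt0 //.
by rewrite mulrC.
Qed.

Variables (phi : 'rV[R]_n -> R) (K lam B : R).
Hypothesis phi_convex : convex_on_Rn phi.
Hypothesis K_ge0 : 0 <= K.
Hypothesis phi_lip :
  forall x y, `|phi x - phi y| <= K * \sum_(i < n) `|x 0 i - y 0 i|.
Hypothesis lam_gt0 : 0 < lam.
Hypothesis B_ge0 : 0 <= B.
Hypothesis exp_int : P.-integrable [set: T]
  (EFin \o (fun w => expR (2 * lam * K * \sum_(i < n) `|X i w|))).

(* The fourth premise says that the slopes of psi are dominated by s times those
   of phi; this carries both Lipschitz bounds of phi over to grad psi at once. *)
Hypothesis entropy_le : forall (psi : 'rV[R]_n -> R) (s : R),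
  0 < s <= lam -> smooth psi -> convex_on_Rn psi ->
  (forall v M, (forall z, phi (z + v) - phi z <= M) ->
    forall x, dot (grad psi x) v <= s * M) ->
  0 < \int[P]_w expR (psi (Z w)) ->
  P.-integrable [set: T] (EFin \o (fun w => expR (psi (Z w)))) ->
  P.-integrable [set: T] (EFin \o (fun w => psi (Z w) * expR (psi (Z w)))) ->
  \int[P]_w (psi (Z w) * expR (psi (Z w))) <=
  (\int[P]_w expR (psi (Z w))) * ln (\int[P]_w expR (psi (Z w))) +
  B * s ^+ 2 * \int[P]_w expR (psi (Z w)).

Lemma exp_dominated_affine (f : T -> R) (c : R) : measurable_fun [set: T] f ->
  (forall w, `|f w| <= c + K * \sum_(i < n) `|X i w|) ->
  P.-integrable [set: T] (EFin \o (fun w => expR (2 * lam * `|f w|))).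
Proof.
move=> mf fle; apply: (le_integrable measurableT _ _
  (integrableZl measurableT (expR (2 * lam * c)) exp_int)).
  apply/measurable_EFinP; apply: (@measurableT_comp _ _ _ _ _ _ (@expR R)).
    exact: measurable_expR.
  by apply: measurable_funM; [exact: measurable_cst|exact: measurableT_comp].
move=> w _ /=; rewrite lee_fin ger0_norm ?expR_ge0 //.
apply: le_trans (ler_norm _); rewrite -expRD ler_expR.
rewrite (_ : _ + _ = 2 * lam * (c + K * \sum_(i < n) `|X i w|)); last by ring.
by rewrite ler_wpM2l // ltW // mulr_gt0.
Qed.

Lemma norm_affine (f : 'rV[R]_n -> R) w :
  (forall x, `|f x - f 0| <= K * \sum_(i < n) `|x 0 i|) ->
  `|f (Z w)| <= `|f 0| + K * \sum_(i < n) `|X i w|.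
Proof.
move=> fK; rewrite -[f (Z w)](subrK (f 0)); apply: le_trans (ler_normD _ _) _.
rewrite addrC lerD2l; apply: le_trans (fK _) _.
by under eq_bigr do rewrite mxE.
Qed.

Section minorants.
Variables (a : nat -> 'rV[R]_n) (b : nat -> R).
Hypothesis minorant : forall j x, dot (a j) x + b j <= phi x.
Hypothesis slope : forall j, exists z, forall v, dot (a j) v <= phi (z + v) - phi z.
Hypothesis tight : forall x eps, 0 < eps -> exists j, phi x - eps <= dot (a j) x + b j.

Let f k : 'rV[R]_n -> R := soft_max a b k 1 0.

Lemma slope_le v M : (forall z, phi (z + v) - phi z <= M) ->
  forall j, dot (a j) v <= M.
Proof. by move=> h j; have [z hz] := slope j; exact: le_trans (hz v) (h z). Qed.

Lemma phi_shift v z : phi (z + v) - phi z <= K * \sum_(i < n) `|v 0 i|.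
Proof.
apply: le_trans (ler_norm _) _; apply: le_trans (phi_lip _ _) _.
rewrite le_eqVlt; apply/orP; left; apply/eqP; congr (K * _).
by apply: eq_bigr => i _; rewrite mxE addrAC subrr add0r.
Qed.

(** The tangents at [x] and at 0 bound the difference from the two sides. *)
Lemma soft_max_lip k x : `|f k x - f k 0| <= K * \sum_(i < n) `|x 0 i|.
Proof.
have gb y v : dot (grad (f k) y) v <= K * \sum_(i < n) `|v 0 i|.
  rewrite -[leRHS]mul1r; apply: dot_grad_soft_max => //.
  by apply: slope_le => z; exact: phi_shift.
have tan y y' : f k y + dot (grad (f k) y) (y' - y) <= f k y'.
  rewrite /f /soft_max grad_lse; apply: lse_tangent.
  by rewrite mul1r ltW // temperature_gt0.
have sN : \sum_(i < n) `|(- x) 0 i| = \sum_(i < n) `|x 0 i|.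
  by apply: eq_bigr => i _; rewrite mxE normrN.
have dN y : dot (grad (f k) y) (- x) = - dot (grad (f k) y) x.
  by rewrite -scaleN1r dotZr mulN1r.
have t1 := tan x 0; rewrite sub0r (dN x) in t1.
have t2 := tan 0 x; rewrite subr0 in t2.
have g1 := gb x x; have g2 := gb 0 (- x); rewrite sN (dN 0) in g2.
exact: norm_sub_le t1 t2 g1 g2.
Qed.

Lemma soft_max_cvg x : f k x @[k --> \oo] --> phi x.
Proof.
apply/cvgrPdist_le => eps e0.
have e2 : 0 < eps / 2 by rewrite divr_gt0.
have [j hj] := tight x _ e2.
near=> k.
have fphi : f k x <= phi x by apply: soft_max_le => i; exact: minorant.
have jk : (j <= k)%N by near: k; exact: nbhs_infty_ge.
have ke : k.+1%:R^-1 < eps / 2 by near: k; exact: near_infty_natSinv_lt (PosNum e2).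
rewrite ger0_norm ?subr_ge0 //.
have := soft_max_ge a b k j x jk; rewrite -/(f k x).
move: hj ke; move: (f k x) (dot _ _ + b j) (phi x) (k.+1%:R^-1) => u p q r; lra.
Unshelve. all: by end_near. Qed.

Lemma measurable_phi : measurable_fun [set: T] (fun w => phi (Z w)).
Proof.
apply: (@measurable_fun_cvg _ _ _ _ (fun k w => f k (Z w))).
  by move=> k; exact: measurable_lse.
by move=> w _; exact: soft_max_cvg.
Qed.

Lemma integrable_phi : P.-integrable [set: T] (EFin \o (fun w => phi (Z w))).
Proof.
apply: (integrable_psi P _ lam) => //; first exact: measurable_phi.
apply: (exp_dominated_affine _ `|phi 0|); first exact: measurable_phi.
move=> w; apply: norm_affine => x; have := phi_lip x 0.
by under eq_bigr do rewrite mxE subr0.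
Qed.

(** Herbst's argument applies to [f k] centered at its mean c, and [f k <= phi] gives c <= E phi.
    The resulting bound is uniform in k, as Fatou's lemma requires. *)
Lemma soft_max_exp_bound k :
  (\int[P]_w (expR (lam * f k (Z w)))%:E <=
   (expR (B * lam ^+ 2 + lam * fine (\int[P]_w (phi (Z w))%:E))%R)%:E)%E.
Proof.
have mf : measurable_fun [set: T] (fun w => f k (Z w)) by exact: measurable_lse.
have fle w : `|f k (Z w)| <= `|f k 0| + K * \sum_(i < n) `|X i w|.
  by apply: norm_affine; exact: soft_max_lip.
have fi : P.-integrable [set: T] (EFin \o (fun w => f k (Z w))).
  apply: (integrable_psi P _ lam) => //.
  exact: (exp_dominated_affine _ _ mf fle).
pose c := \int[P]_w f k (Z w).
pose psi w := f k (Z w) - c.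
have mpsi : measurable_fun [set: T] psi.
  by apply: measurable_funB => //; exact: measurable_cst.
have psile w : `|psi w| <= (`|f k 0| + `|c|) + K * \sum_(i < n) `|X i w|.
  apply: le_trans (ler_normB _ _) _; have := fle w; lra.
have psi_int := exp_dominated_affine _ _ mpsi psile.
have ci : P.-integrable [set: T] (EFin \o (cst c)).
  exact: finite_measure_integrable_cst.
have psi0 : \int[P]_w psi w = 0.
  rewrite RintegralB // Rintegral_cst // [X in fine X]probability_setT mulr1.
  by rewrite subrr.
have psiE s w : soft_max a b k s c (Z w) = s * psi w by exact: soft_maxE.
have H s : 0 < s <= lam -> \int[P]_w (s * psi w * expR (s * psi w)) <=
    (\int[P]_w expR (s * psi w)) * ln (\int[P]_w expR (s * psi w)) +
    B * s ^+ 2 * \int[P]_w expR (s * psi w).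
  move=> sl; have /andP[s0 sl1] := sl; have sl' : 0 <= s <= lam by rewrite ltW.
  have ie := integrable_expRZ P psi lam mpsi lam_gt0 psi_int s sl'.
  have iM := integrable_MexpRZ P psi lam mpsi psi_int s sl'.
  have := entropy_le (soft_max a b k s c) s sl (smooth_soft_max _ _ _ _ _)
    (convex_soft_max _ _ _ _ _ (ltW s0)).
  rewrite (_ : (fun w => expR (soft_max a b k s c (Z w))) =
    (fun w => expR (s * psi w))); last by apply/funext => w; rewrite psiE.
  rewrite (_ : (fun w => soft_max a b k s c (Z w) *
      expR (soft_max a b k s c (Z w))) =
    (fun w => s * psi w * expR (s * psi w))); last first.
    by apply/funext => w; rewrite psiE.
  apply=> //; last exact: (mgf_gt0 P psi lam).
  move=> v M hM x; apply: dot_grad_soft_max; first exact: ltW.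
  exact: slope_le.
have h := herbst P psi lam B mpsi lam_gt0 B_ge0 psi_int psi0 H.
have cphi : c <= fine (\int[P]_w (phi (Z w))%:E).
  apply: le_Rintegral => //; first exact: integrable_phi.
  by move=> w _; apply: soft_max_le => i; exact: minorant.
have ie : P.-integrable [set: T] (EFin \o (fun w => expR (lam * psi w))).
  apply: (integrable_expRZ P psi lam mpsi lam_gt0 psi_int).
  by rewrite lexx ltW.
have -> : (fun w => (expR (lam * f k (Z w)))%:E) =
    (fun w => (expR (lam * c) * expR (lam * psi w))%:E).
  by apply/funext => w; rewrite -expRD /psi; congr (expR _)%:E; ring.
under eq_integral do rewrite EFinM.
rewrite integralZl // (EFin_Rintegral P (fun w => expR (lam * psi w)) ie).
rewrite -EFinM lee_fin.
apply: (@le_trans _ _ (expR (lam * c) * expR (B * lam ^+ 2))).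
  by rewrite ler_wpM2l ?expR_ge0.
by rewrite -expRD ler_expR addrC lerD2l ler_wpM2l // ltW.
Qed.

End minorants.

Lemma phi_exp_bound :
  P.-integrable [set: T] (EFin \o (fun w => phi (Z w))) /\
  measurable_fun [set: T] (fun w => phi (Z w)) /\
  (\int[P]_w (expR (lam * phi (Z w)))%:E <=
   (expR (B * lam ^+ 2 + lam * fine (\int[P]_w (phi (Z w))%:E))%R)%:E)%E.
Proof.
have [a [b [minorant slope tight]]] :=
  affine_minorants phi K phi_convex K_ge0 phi_lip.
have mphi := measurable_phi a b minorant tight.
split; first exact: (integrable_phi a b minorant tight).
split=> //.
set M := (X in (_ <= X)%E).
pose u k w := (expR (lam * soft_max a b k 1 0 (Z w)))%:E.
have u0 k w : (0 <= u k w)%E by rewrite lee_fin expR_ge0.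
have mu' k : measurable_fun [set: T] (u k).
  apply/measurable_EFinP; apply: (@measurableT_comp _ _ _ _ _ _ (@expR R)).
    exact: measurable_expR.
  apply: measurable_funM; [exact: measurable_cst|exact: measurable_lse].
have -> : (fun w => (expR (lam * phi (Z w)))%:E) = (fun w => limn_einf (u ^~ w)).
  apply/funext => w; apply/esym.
  suff cu : u ^~ w @ \oo --> (expR (lam * phi (Z w)))%:E.
    exact: (cvg_limn_einf_sup cu).1.
  apply/fine_cvgP; split; first exact: nearW.
  have cE : {for phi (Z w), continuous (fun y => expR (lam * y))}.
    apply: (@continuous_comp _ _ _ ( *%R lam) expR).
      exact: mulrl_continuous.
    exact: continuous_expR.
  exact: (continuous_cvg _ cE (soft_max_cvg a b minorant tight (Z w))).
apply: le_trans (fatou _ _ mu' _) _ => //.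
rewrite limn_einf_lim; apply: lime_le; first exact: is_cvg_einfs.
apply: nearW => k; apply: (@le_trans _ _ (\int[P]_w u k w)%E).
  by apply: ereal_inf_lbound; exists k => /=.
exact: (soft_max_exp_bound a b minorant slope tight k).
Qed.

Lemma exponential_concentration t :
  (P [set w | 'E_P[fun w => phi (Z w)] + t%:E <= (phi (Z w))%:E] <=
   (expR (B * lam ^+ 2 - lam * t))%:E)%E.
Proof.
have [iphi [mphi h]] := phi_exp_bound.
rewrite expectation.unlock (EFin_Rintegral P (fun w => phi (Z w)) iphi).
set c := \int[P]_w phi (Z w).
have := chernoff_bound _ lam (c + t) _ mphi (ltW lam_gt0) h.
rewrite -/(Rintegral _ _ _) -/c.
by rewrite (_ : _ - _ = B * lam ^+ 2 - lam * t) //; ring.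
Qed.

End exponential_concentration.

(** * Concentration *)

(* exp(-1/6) >= 5/6, and (5/6)^6 > 1/3. *)
Lemma expR1_lt3 (R : realType) : expR 1 < 3 :> R.
Proof.
pose y : R := expR (- (1 / 6)).
have y56 : 5 / 6 <= y by have := expR_ge1Dx (- (1 / 6) : R); rewrite -/y; lra.
have y3 : 26 / 45 <= y ^+ 3.
  apply: (@le_trans _ _ ((5 / 6) ^+ 3)); first by rewrite !exprS expr0; lra.
  by rewrite lerXn2r // nnegrE; lra.
have y6 : (26 / 45) ^+ 2 <= y ^+ 3 ^+ 2 by rewrite lerXn2r // nnegrE; lra.
have : expR 1 * (y ^+ 3 ^+ 2) = 1.
  rewrite -!exprM /y -expRM_natr -expRD -[RHS]expR0; congr expR.
  by rewrite natrM; lra.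
have e0 : 0 < expR 1 :> R by exact: expR_gt0.
have : (1 / 3) * expR 1 < (26 / 45) ^+ 2 * expR 1 :> R.
  by rewrite ltr_pM2r // expr2; lra.
have := ler_wpM2l (ltW e0) y6; lra.
Qed.

Section concentration.
Context {d : measure_display} {T : measurableType d} {R : realType}.
Context {P : probability T R} {n : nat}.
Variables (X : 'I_n -> {RV P >-> R}) (phi : 'rV[R]_n -> R).
Variables (beta m sigma C : R).
Hypothesis beta_ge0 : 0 <= beta.
Hypothesis m_gt0 : 0 < m.
Hypothesis sigma_ge0 : 0 <= sigma.
Hypothesis C_gt0 : 0 < C.
Hypothesis X_indep : mutually_independent X.
Hypothesis X_law :
  forall i, class_M beta m (sigma `^ (beta + 1)) (distribution P (X i)).
Hypothesis phi_convex : convex_on_Rn phi.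

Let Y w := phi (random_vector X w).

(** As x^beta is unbounded, the decay ratio can be made as small as desired far out. Here q = exp(-
    l) / 2 makes the geometric ratio 1/2 for steps of length 1, and N is taken beyond both m and the
    point M where q M^beta = s. *)
Lemma exp_moments_pos (l : R) : 0 < beta -> 0 <= l ->
  P.-integrable [set: T] (EFin \o (fun w => expR (l * \sum_(i < n) `|X i w|))).
Proof.
move=> b0 l0.
pose s := sigma `^ (beta + 1); pose q := expR (- l) / 2.
have q0 : 0 < q by rewrite divr_gt0 // expR_gt0.
have s0 : 0 <= s by exact: powR_ge0.
pose M := (s / q) `^ beta^-1.
have M0 : 0 <= M by exact: powR_ge0.
pose N := (Num.trunc (m + M)).+1.
have NM : m + M <= N%:R by rewrite ltW // truncnS_gt.
have e1 : expR (- l) <= 1 by rewrite expR_le1 oppr_le0.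
apply: (integrable_expR_sum_norm n X beta m s l N 1 q) => //.
- by rewrite q0 /q /=; lra.
- by rewrite mulr1; apply: le_trans NM; rewrite lerDl.
- rewrite mul1r mulr1 mulrC -ler_pdivrMr //.
  have -> : s / q = M `^ beta.
    by rewrite /M -powRrM mulVf ?gt_eqF // powRr1 // divr_ge0 // ltW.
  rewrite ge0_ler_powR ?nnegrE ?(ltW b0) //.
  by apply: le_trans NM; rewrite lerDr ltW.
- by rewrite mulr1 /q mulrA -expRD subrr expR0; lra.
Qed.

(** For beta = 0 the weight is 1 and the decay ratio over a step a is sigma / a. The step a = m + 3
    sigma, with N = 1, reaches m at once and gives a ratio at most 1/3, while exp(l a) <= e < 3. *)
Lemma exp_moments_0 (l : R) : beta = 0 -> 0 <= l <= (m + 3 * sigma)^-1 ->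
  P.-integrable [set: T] (EFin \o (fun w => expR (l * \sum_(i < n) `|X i w|))).
Proof.
move=> b0 /andP[l0 l1].
have a0 : 0 < m + 3 * sigma by rewrite ltr_pwDl // mulr_ge0.
have m0 := m_gt0.
have sE : sigma `^ (beta + 1) = sigma by rewrite b0 add0r powRr1.
have la : l * (m + 3 * sigma) <= 1 by rewrite -ler_pdivlMr // div1r.
have e3 : expR (l * (m + 3 * sigma)) < 3.
  by apply: le_lt_trans (expR1_lt3 R); rewrite ler_expR.
apply: (integrable_expR_sum_norm n X beta m (sigma `^ (beta + 1)) _ 1
  (m + 3 * sigma) (1 / 3)) => //.
- by apply/andP; split; lra.
- by rewrite mul1r lerDl mulr_ge0.
- by rewrite sE b0 powRr0 mulr1; lra.
- by lra.
Qed.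

Section bound.
Variables (K lam B t : R).
Hypothesis K_ge0 : 0 <= K.
Hypothesis phi_lip :
  forall x y, `|phi x - phi y| <= K * lpnorm 1 (x - y).
Hypothesis lam_gt0 : 0 < lam.
Hypothesis B_ge0 : 0 <= B.
Hypothesis exp_int : P.-integrable [set: T]
  (EFin \o (fun w => expR (2 * lam * K * \sum_(i < n) `|X i w|))).

(** [G] stands for the gradient functional of either case, so that beta > 0 and beta = 0 share the
    argument; division by [C] makes the final coefficient of s^2 equal to [B]. *)
Lemma mlsi_concentration
  (G : ('rV[R]_n -> R) -> 'rV[R]_n -> R)
  (G_le : forall psi s, 0 < s <= lam -> smooth psi ->
    (forall v M, (forall z, phi (z + v) - phi z <= M) ->
      forall x, dot (grad psi x) v <= s * M) ->
    forall x, 0 <= G psi x <= B / C * s ^+ 2)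
  (Ent_le : forall psi s, 0 < s <= lam -> smooth psi -> convex_on_Rn psi ->
    (forall v M, (forall z, phi (z + v) - phi z <= M) ->
      forall x, dot (grad psi x) v <= s * M) ->
    (Ent P (fun w => expR (psi (random_vector X w))) <=
     C%:E * 'E_P[fun w => (G psi (random_vector X w) *
                           expR (psi (random_vector X w)))%R])%E) :
  (P [set w | 'E_P[Y] + t%:E <= (Y w)%:E] <= (expR (B * lam ^+ 2 - lam * t))%:E)%E.
Proof.
apply: (exponential_concentration X phi K lam B) => //.
  move=> x y; apply: le_trans (phi_lip x y) _; rewrite lpnorm1.
  by under eq_bigr do rewrite !mxE.
move=> psi s sl psi_smooth psi_convex psi_grad F0 ie iM.
have GB := G_le psi s sl psi_smooth psi_grad.
have := Ent_expR_le P (psi \o random_vector X) (G psi \o random_vector X) C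
  (B / C * s ^+ 2) ie iM (ltW C_gt0) F0 (fun w => GB _)
  (Ent_le psi s sl psi_smooth psi_convex psi_grad).
by rewrite mulrA [C * _]mulrC mulfVK // gt_eqF.
Qed.

End bound.
End concentration.

Lemma lpnorm_delta_gt0 (R : realType) (n : nat) (p : R) (i : 'I_n) :
  0 < lpnorm p (delta_mx 0 i : 'rV[R]_n).
Proof.
apply: powR_gt0; rewrite (bigD1 i) //= mxE !eqxx normr1 powR1 ltr_pwDl //.
by apply: sumr_ge0 => j _; exact: powR_ge0.
Qed.

Lemma lipschitz_ge0 (R : realType) (n : nat) (phi : 'rV[R]_n -> R) (p L : R) :
  (0 < n)%N -> (forall x y, `|phi x - phi y| <= L * lpnorm p (x - y)) -> 0 <= L.
Proof.
move=> n0 h; have := h (delta_mx 0 (Ordinal n0)) 0; rewrite subr0 => hL.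
have := le_trans (normr_ge0 _) hL.
by rewrite pmulr_lge0 // lpnorm_delta_gt0.
Qed.

(* The choice lam = M / (2 t), where M is the minimum in the exponent. *)
Lemma chernoff_optimum (R : realType) (t A M : R) : 0 < t -> 0 <= M ->
  A <= M / 4 -> A - M / (2 * t) * t <= - (1 / 4 * M).
Proof.
move=> t0 M0 AM; rewrite (_ : M / (2 * t) * t = M / 2); first lra.
by field; rewrite gt_eqF.
Qed.

Lemma quadratic_budget (R : realType) (C L t M : R) : 0 < C -> 0 < L -> 0 < t ->
  0 <= M -> M <= t ^+ 2 / (C * L ^+ 2) ->
  C * L ^+ 2 * (M / (2 * t)) ^+ 2 <= M / 4.
Proof.
move=> C0 L0 t0 M0; rewrite ler_pdivlMr ?mulr_gt0 ?exprn_gt0 // => h.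
rewrite (_ : _ * _ = M / 4 * (M * (C * L ^+ 2) / t ^+ 2)); last first.
  by field; rewrite gt_eqF.
rewrite ler_piMr ?divr_ge0 // ler_pdivrMr ?exprn_gt0 // mul1r //.
Qed.

(** The bound on M raised to the power 1 / beta reads M^(1/beta) C L^q <= t^q. As M^q = M
    M^(1/beta), the left side is at most M / 2^q, and q >= 2. *)
Lemma power_budget (R : realType) (beta C L t M : R) (q := (beta + 1) / beta) :
  0 < beta <= 1 -> 0 < C -> 0 < L -> 0 < t -> 0 <= M ->
  M <= t `^ (1 + beta) / (C `^ beta * L `^ (1 + beta)) ->
  C * ((M / (2 * t)) * L) `^ q <= M / 4.
Proof.
move=> /andP[b0 b1] C0 L0 t0.
rewrite le_eqVlt => /predU1P[<- _|M0 h].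
  by rewrite !mul0r powR0 ?mulr0 // gt_eqF // divr_gt0 //; lra.
have q2 : 2 <= q by rewrite /q ler_pdivlMr //; lra.
have bV : 0 <= beta^-1 by rewrite invr_ge0 ltW.
have D0 : 0 < C `^ beta * L `^ (1 + beta) by rewrite mulr_gt0 ?powR_gt0.
have hq : M `^ beta^-1 * (C * L `^ q) <= t `^ q.
  have qE : (1 + beta) * beta^-1 = q by rewrite /q [1 + _]addrC.
  move: h; rewrite ler_pdivlMr // => h.
  have := ge0_ler_powR bV _ _ h; rewrite !nnegrE powR_ge0 mulr_ge0 ?(ltW M0) ?(ltW D0) //.
  move=> /(_ isT isT); rewrite !powRM ?powR_ge0 ?(ltW M0) ?(ltW D0) // -!powRrM.
  by rewrite divff ?gt_eqF // qE powRr1 // ltW.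
have M1 : M `^ q = M * M `^ beta^-1.
  rewrite -{2}(powRr1 (ltW M0)) -powRD ?(gt_eqF M0) ?implybT //.
  by congr (_ `^ _); rewrite /q; field; rewrite gt_eqF.
have q24 : 4 <= 2 `^ q :> R.
  apply: (@le_trans _ _ (2 `^ 2%:R)); first by rewrite powR_mulrn // expr2; lra.
  by rewrite ler_powR //; lra.
have t0' : 0 < 2 * t by rewrite mulr_gt0.
have tq0 : 0 < t `^ q by rewrite powR_gt0.
have -> : C * (M / (2 * t) * L) `^ q =
    M / 2 `^ q * (M `^ beta^-1 * (C * L `^ q) / t `^ q).
  have i0 : 0 <= (2 * t)^-1 by rewrite invr_ge0 ltW.
  have iE : (2 * t)^-1 `^ q = (2 `^ q * t `^ q)^-1.
    rewrite -powR_inv1 ?(ltW t0') // powRAC powR_inv1 ?powR_ge0 //.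
    by rewrite powRM // ltW.
  rewrite powRM; [|by rewrite mulr_ge0 // ltW|exact: ltW].
  rewrite powRM ?(ltW M0) // M1 iE; field.
  by rewrite !gt_eqF ?powR_gt0.
apply: (@le_trans _ _ (M / 2 `^ q)).
  apply: ler_piMr; first by rewrite divr_ge0 ?powR_ge0 ?(ltW M0).
  by rewrite ler_pdivrMr // mul1r.
by rewrite ler_pM2l // lef_pV2 ?posrE // powR_gt0.
Qed.

(* The bounds are written in \bar R, where a / 0 = +oo for a > 0, 0 / 0 = 0 and
   expeR (- +oo) = 0; this is the meaning of the estimates when phi is constant
   and a Lipschitz constant is 0. *)
Theorem corollary1p7 (R : realType) (beta m sigma C : R)
  (beta01 : 0 <= beta <= 1) (m_gt0 : 0 < m) (sigma_ge0 : 0 <= sigma)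
  (C_gt0 : 0 < C) (C_mlsi : mlsi_constant beta m sigma C)
  (n : nat) (n_gt0 : (0 < n)%N)
  (d : measure_display) (T : measurableType d) (P : probability T R)
  (X : 'I_n -> {RV P >-> R}) (X_indep : mutually_independent X)
  (X_law : forall i,
     class_M beta m (sigma `^ (beta + 1)) (distribution P (X i)))
  (phi : 'rV[R]_n -> R) (phi_convex : convex_on_Rn phi)
  (L2 L1b : R)
  (phi_L2 : forall x y, `|phi x - phi y| <= L2 * lpnorm 2 (x - y))
  (phi_L1b : forall x y,
     `|phi x - phi y| <= L1b * lpnorm (1 + beta) (x - y)) :
  let Y : T -> R := fun w => phi (random_vector X w) in
  (0 < beta -> forall t : R, 0 <= t ->
     (P [set w | 'E_P[Y] + t%:E <= (Y w)%:E] <=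
      expeR (- ((3 / 16)%R%:E *
        Order.min ((t ^+ 2)%R%:E / (C * L2 ^+ 2)%R%:E)
          ((t `^ (1 + beta))%R%:E /
             (C `^ beta * L1b `^ (1 + beta))%R%:E))))%E) /\
  (beta = 0 -> forall t : R, 0 <= t ->
     (P [set w | 'E_P[Y] + t%:E <= (Y w)%:E] <=
      expeR (- ((1 / 4)%R%:E *
        Order.min ((t ^+ 2)%R%:E / (C * L2 ^+ 2)%R%:E)
          (t%:E / ((m + 3 * sigma) * L1b)%R%:E))))%E).
Proof.
have /andP[beta0 beta1] := beta01.
have L20 := lipschitz_ge0 R n phi 2 L2 n_gt0 phi_L2.
have L10 := lipschitz_ge0 R n phi (1 + beta) L1b n_gt0 phi_L1b.
move=> Y.
have phi1_L2 x y : `|phi x - phi y| <= L2 * lpnorm 1 (x - y).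
  exact: (le_trans (phi_L2 x y) (ler_wpM2l L20 (lpnorm2_le_lpnorm1 _))).
have PE t : (P [set w | 'E_P[Y] + t%:E <= (Y w)%:E] <= 1)%E.
  apply: probability_le1.
  have [x y|a [b [minorant _ tight]]] := affine_minorants phi L2 phi_convex L20.
    apply: le_trans (phi1_L2 x y) _; rewrite lpnorm1.
    by under eq_bigr do rewrite !mxE.
  have mY := measurable_phi X phi a b minorant tight.
  rewrite -[X in measurable X]setTI.
  by apply: emeasurable_fun_c_infty => //; exact/measurable_EFinP.
(* If a Lipschitz constant is 0, then [phi] is constant and the event is empty for t > 0, so every
   exponent is admissible, an infinite one included. *)
have const t (e : \bar R) : 0 < t -> (forall x y, `|phi x - phi y| <= 0) ->
    (P [set w | 'E_P[Y] + t%:E <= (Y w)%:E] <= expeR e)%E.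
  move=> t0 phi0.
  have YE : Y = cst (phi 0).
    apply/funext => w; apply/eqP; rewrite -subr_eq0 -normr_le0; exact: phi0.
  rewrite YE expectation_cst (_ : mkset _ = set0).
    by rewrite measure0 expeR_ge0.
  by apply/seteqP; split=> // w /=; rewrite -EFinD lee_fin gerDl leNgt t0.
split=> [b0|b0] t; rewrite le_eqVlt => /predU1P[<-|t0].
- rewrite expr0n /= powR0 ?gt_eqF ?ltr_wpDr // !mul0e minxx mule0 oppe0 expeR0.
  exact: PE.
- move: L20; rewrite le_eqVlt => /predU1P[L2E|L20].
    by apply: const => // x y; have := phi_L2 x y; rewrite -L2E mul0r.
  move: L10; rewrite le_eqVlt => /predU1P[L1E|L10].
    by apply: const => // x y; have := phi_L1b x y; rewrite -L1E mul0r.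
  rewrite !inver !gt_eqF ?mulr_gt0 ?exprn_gt0 ?powR_gt0 // -!EFinM -EFin_min.
  rewrite -EFinM -EFinN /=.
  set M := Num.min _ _.
  have M0 : 0 < M.
    by rewrite lt_min !divr_gt0 ?mulr_gt0 ?exprn_gt0 ?powR_gt0.
  have [M1 M2] : M <= t ^+ 2 / (C * L2 ^+ 2) /\
      M <= t `^ (1 + beta) / (C `^ beta * L1b `^ (1 + beta)).
    by rewrite !ge_min !lexx orbT.
  pose lam := M / (2 * t).
  have lam0 : 0 < lam by rewrite divr_gt0 // mulr_gt0.
  pose q := (beta + 1) / beta.
  have q2 : 2 <= q by rewrite /q ler_pdivlMr //; lra.
  (* The coefficient of s^2 that dominates both gradient terms for s <= lam. *)
  pose D := Num.max (L2 ^+ 2) (lam `^ (q - 2) * L1b `^ q).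
  have D0 : 0 <= D by rewrite le_max sqr_ge0.
  have split_pow s : 0 < s -> s `^ (q - 2) * s ^+ 2 = s `^ q.
    move=> s0; rewrite -powR_mulrn ?(ltW s0) // -powRD ?(gt_eqF s0) ?implybT //.
    by rewrite subrK.
  have lamL0 : 0 <= 2 * lam * L2.
    exact: mulr_ge0 (mulr_ge0 (ler0n _ 2) (ltW lam0)) (ltW L20).
  have conc := mlsi_concentration X phi C C_gt0 phi_convex L2 lam (C * D) t
    (ltW L20) phi1_L2 lam0 (mulr_ge0 (ltW C_gt0) D0)
    (exp_moments_pos X beta m sigma beta0 m_gt0 X_indep X_law _ b0 lamL0)
    (fun psi x => Num.max (lpnorm 2 (grad psi x) ^+ 2)
                          (lpnorm q (grad psi x) `^ q)).
  apply: le_trans (conc _ _) _ => {conc}.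
  + move=> psi s /andP[s0 sl] _ psi_grad x.
    rewrite le_max sqr_ge0 /= [C * D]mulrC mulfK ?gt_eqF // ge_max.
    have g2 : lpnorm 2 (grad psi x) ^+ 2 <= (s * L2) ^+ 2.
      apply: dual_lpnorm2 => v; rewrite -mulrA; apply: psi_grad => z.
      apply: le_trans (ler_norm _) _; apply: le_trans (phi_L2 _ _) _.
      by rewrite addrAC subrr add0r.
    have gq : lpnorm q (grad psi x) `^ q <= (s * L1b) `^ q.
      apply: dual_lpnorm => // [|v]; first by rewrite mulr_ge0 // ltW.
      rewrite -mulrA; apply: psi_grad => z.
      apply: le_trans (ler_norm _) _; apply: le_trans (phi_L1b _ _) _.
      by rewrite addrAC subrr add0r.
    apply/andP; split.
      apply: le_trans g2 _; rewrite exprMn mulrC ler_wpM2r ?sqr_ge0 //.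
      by rewrite le_max lexx.
    apply: le_trans gq _; rewrite powRM ?(ltW s0) ?(ltW L10) // -split_pow //.
    rewrite mulrAC ler_wpM2r ?sqr_ge0 //.
    rewrite le_max; apply/orP; right; rewrite ler_wpM2r ?powR_ge0 //.
    by rewrite ge0_ler_powR ?nnegrE ?subr_ge0 ?(ltW s0) ?(ltW lam0).
  + move=> psi s _ psi_smooth psi_convex _.
    exact: (C_mlsi n d T P X psi n_gt0 X_indep X_law psi_smooth psi_convex).1.
  rewrite lee_fin ler_expR.
  (* At s = lam the two candidates for D lam^2 are exactly (lam L2)^2 and (lam L1b)^q, each matched
     to one term of the minimum. *)
  have budget : C * D * lam ^+ 2 <= M / 4.
    rewrite /D maxEle; case: ifP => _.
      rewrite -mulrA mulrAC split_pow // -powRM ?(ltW lam0) ?(ltW L10) //.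
      by apply: power_budget => //; rewrite ?b0 ?(ltW M0).
    by apply: quadratic_budget => //; exact: ltW.
  apply: le_trans (chernoff_optimum R t _ M t0 (ltW M0) budget) _.
  (* The bound obtained has 1/4, which is larger than the stated 3/16. *)
  by rewrite lerN2 ler_wpM2r ?(ltW M0) //; lra.
- rewrite expr0n /= !mul0e minxx mule0 oppe0 expeR0; exact: PE.
- move: L20; rewrite le_eqVlt => /predU1P[L2E|L20].
    by apply: const => // x y; have := phi_L2 x y; rewrite -L2E mul0r.
  move: L10; rewrite le_eqVlt => /predU1P[L1E|L10].
    by apply: const => // x y; have := phi_L1b x y; rewrite -L1E mul0r.
  have ms0 : 0 < m + 3 * sigma by rewrite ltr_pwDl // mulr_ge0.
  rewrite !inver !gt_eqF ?mulr_gt0 ?exprn_gt0 // -!EFinM -EFin_min.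
  rewrite -EFinM -EFinN /=.
  set M := Num.min _ _.
  have M0 : 0 < M by rewrite lt_min !divr_gt0 ?mulr_gt0 ?exprn_gt0.
  have [M1 M2] : M <= t ^+ 2 / (C * L2 ^+ 2) /\ M <= t / ((m + 3 * sigma) * L1b).
    by rewrite !ge_min !lexx orbT.
  pose lam := M / (2 * t).
  have lam0 : 0 < lam by rewrite divr_gt0 // mulr_gt0.
  have phi_L1 x y : `|phi x - phi y| <= L1b * lpnorm 1 (x - y).
    by have := phi_L1b x y; rewrite b0 addr0.
  (* Used twice: for the exponential moments at rate 2 lam L1b, and for the restriction on the
     partial derivatives, since these are at most lam L1b. *)
  have lamL : 2 * lam * L1b <= (m + 3 * sigma)^-1.
    rewrite -[leRHS]div1r ler_pdivlMr //; move: M2.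
    rewrite ler_pdivlMr ?mulr_gt0 // => M2.
    have -> : 2 * lam * L1b * (m + 3 * sigma) = M * ((m + 3 * sigma) * L1b) / t.
      by rewrite /lam; field; rewrite gt_eqF.
    by rewrite ler_pdivrMr // mul1r.
  have lamL0 : 0 <= 2 * lam * L1b.
    exact: mulr_ge0 (mulr_ge0 (ler0n _ 2) (ltW lam0)) (ltW L10).
  have ml : 0 <= 2 * lam * L1b <= (m + 3 * sigma)^-1 by rewrite lamL0.
  have conc := mlsi_concentration X phi C C_gt0 phi_convex L1b lam (C * L2 ^+ 2) t
    (ltW L10) phi_L1 lam0 (mulr_ge0 (ltW C_gt0) (sqr_ge0 L2))
    (exp_moments_0 X beta m sigma beta0 m_gt0 sigma_ge0 X_indep X_law _ b0 ml)
    (fun psi x => lpnorm 2 (grad psi x) ^+ 2).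
  apply: le_trans (conc _ _) _ => {conc}.
  + move=> psi s /andP[s0 sl] _ psi_grad x.
    rewrite sqr_ge0 /= [C * _]mulrC mulfK ?gt_eqF // mulrC -exprMn.
    apply: dual_lpnorm2 => v; rewrite -mulrA; apply: psi_grad => z.
    apply: le_trans (ler_norm _) _; apply: le_trans (phi_L2 _ _) _.
    by rewrite addrAC subrr add0r.
  + move=> psi s /andP[s0 sl] psi_smooth psi_convex psi_grad.
    apply: (C_mlsi n d T P X psi n_gt0 X_indep X_law psi_smooth psi_convex).2 => //.
    move=> i x.
    have gi : `|grad psi x 0 i| <= s * L1b.
      apply: dual_lpnorm1 => v; rewrite -mulrA; apply: psi_grad => z.
      apply: le_trans (ler_norm _) _; apply: le_trans (phi_L1 _ _) _.
      by rewrite addrAC subrr add0r.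
    move: gi; rewrite mxE => /le_trans; apply.
    apply: (@le_trans _ _ (lam * L1b)); first by rewrite ler_wpM2r // ltW.
    by rewrite div1r invfM -ler_pdivrMl ?invr_gt0 // invrK mulrA.
  rewrite lee_fin ler_expR.
  apply: chernoff_optimum => //; first exact: ltW.
  by apply: quadratic_budget => //; exact: ltW.
Qed.
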